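(* Let $L$ be an $n$-dimensional complex non-Lie Leibniz algebra of level two. Then $L$ is isomorphic to one of the following algebras, each given by its nonzero products in a basis $e_1,\dots,e_n$: \begin{align*} L_4(\alpha)\oplus \mathfrak{a}_{n-3} &: \quad e_1e_1=e_3,\quad e_2e_1=e_3,\quad e_2e_2=\alpha e_3 \qquad (\text{for some } \alpha\in\mathbb{C});\\ L_5\oplus \mathfrak{a}_{n-3} &: \quad e_1e_1=e_3,\quad e_1e_2=e_3,\quad e_2e_1=e_3;\\ r_n &: \quad e_ie_1=e_i,\quad 2\le i\le n. \end{align*}
   Context: An $n$-dimensional complex algebra is an $n$-dimensional complex vector space $V$ with a bilinear (not necessarily associative) multiplication $\lambda\in\mathrm{Hom}(V\otimes V,V)$; the set of these is $\mathrm{Alg}_n(\mathbb{C})$, an affine space with the Zariski topology. $GL_n(\mathbb{C})$ acts by $(g*\lambda)(x,y)=g(\lambda(g^{-1}(x),g^{-1}(y)))$; the orbit $\mathrm{Orb}(\lambda)$ is the set of multiplications isomorphic to $\lambda$. We say $\lambda$ degenerates to $\mu$, written $\lambda\to\mu$, if $\mathrm{Orb}(\mu)\subseteq\overline{\mathrm{Orb}(\lambda)}$ (Zariski closure). The degeneration is trivial if $\lambda\simeq\mu$, and direct if it is non-trivial and there is no $\nu$ (isomorphic to neither $\lambda$ nor $\mu$) with $\lambda\to\nu\to\mu$. The level of $\lambda$ is the maximum length of a chain of direct degenerations from $\lambda$ to the abelian algebra of dimension $n$ (the one with zero multiplication). A (right) Leibniz algebra is an algebra satisfying $x(yz)=(xy)z-(xz)y$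 for all $x,y,z$. An antisymmetric Leibniz algebra is a Lie algebra; ''non-Lie'' means it is not a Lie algebra. $\mathfrak{a}_m$ denotes the $m$-dimensional abelian algebra (zero multiplication). In multiplication tables, products of basis elements that are not listed are zero. Algebras involving $\mathfrak{a}_{n-3}$ occur only when $n\ge 3$. *)

(* Defs.v *)
(* MathComp with multinomials *)
From HB Require Import structures.
From mathcomp Require Import all_boot all_order all_algebra.
From mathcomp Require Import reals complex mpoly.

Set Implicit Arguments.
Unset Strict Implicit.
Unset Printing Implicit Defensive.

Import GRing.Theory.
Local Open Scope ring_scope.

Section Zariski.
Variables (F : fieldType) (E : vectType F).

(* Polynomial functions on E are polynomials in the coordinates with respect
   to one fixed basis of E; they do not depend on the basis. *)
Definition peval (p : {mpoly F[\dim {:E}]}) (x : E) : F :=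
  p.@[fun i => coord (vbasis {:E}) i x].

Definition zariski_closed (Z : E -> Prop) : Prop :=
  exists P : {mpoly F[\dim {:E}]} -> Prop,
    forall x, Z x <-> (forall p, P p -> peval p x = 0).

Definition zariski_closure (S : E -> Prop) (x : E) : Prop :=
  forall Z, zariski_closed Z -> (forall y, S y -> Z y) -> Z x.

End Zariski.

(* Hom(V (x) V, V) in curried form: the product of x and y is [l x y]. This is
   a vector space of dimension n ^ 3 when V has dimension n. *)
Notation alg V := 'Hom(V, 'Hom(V, V)).

Definition isomorphic (F : fieldType) (V W : vectType F)
    (l : alg V) (m : alg W) : Prop :=
  exists2 f : 'Hom(V, W), bijective f & forall x y, f (l x y) = m (f x) (f y).

Section Degeneration.
Variables (F : fieldType) (V : vectType F).
Implicit Types (g : 'End(V)) (l m : alg V).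

Definition gl g : Prop := lker g == 0%VS.

Definition gact g l : alg V :=
  linfun (fun x : V => (g \o l (g^-1%VF x) \o g^-1)%VF).

Lemma gactE g l x y : gact g l x y = g (l (g^-1%VF x) (g^-1%VF y)).
Proof.
pose h (x : V) := (g \o l (g^-1%VF x) \o g^-1)%VF.
have lin : linear h.
  move=> a u v; apply/lfunP => z; rewrite !lfunE /= !lfunE /= !lfunE /=.
  by rewrite !linearP !lfunE /= !lfunE /= !linearP.
pose f : {linear V -> 'Hom(V, V)} :=
  HB.pack h (GRing.isLinear.Build _ _ _ _ _ lin).
by rewrite /gact (lfunE f) /= !lfunE /= !lfunE.
Qed.

Definition orbit l m : Prop := exists2 g, gl g & m = gact g l.

Lemma orbitP l m : orbit l m <-> isomorphic l m.
Proof.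
split=> [[g /eqP kg ->]|[f bf fM]].
  have kg0 : lker g == 0%VS by apply/eqP.
  exists g; first exact: Bijective (lker0_lfunK kg0) (lker0_lfunVK kg0).
  by move=> x y; rewrite gactE !(lker0_lfunK kg0).
have kf : lker f == 0%VS by apply/lker0P; apply: bij_inj.
by exists f => //; apply/lfunP => x; apply/lfunP => y;
  rewrite gactE fM !(lker0_lfunVK kf).
Qed.

Definition degenerates l m : Prop :=
  forall m', orbit m m' -> zariski_closure (orbit l) m'.

Definition direct_degeneration l m : Prop :=
  [/\ degenerates l m, ~ isomorphic l m &
      ~ exists v : alg V, [/\ ~ isomorphic v l, ~ isomorphic v m,
                              degenerates l v & degenerates v m]].

(* The length of a chain is its number of degenerations; 0 is the abelian
   algebra on V. *)
Definition direct_chain l (k : nat) : Prop :=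
  exists c : nat -> alg V,
    [/\ c 0%N = l, c k = 0 &
        forall i, (i < k)%N -> direct_degeneration (c i) (c i.+1)].

Definition has_level l (k : nat) : Prop :=
  direct_chain l k /\ (forall k', direct_chain l k' -> (k' <= k)%N).

Definition leibniz l : Prop :=
  forall x y z, l x (l y z) = l (l x y) z - l (l x z) y.

Definition lie l : Prop := leibniz l /\ (forall x y, l x y = - l y x).

End Degeneration.

Section Tables.
Variables (F : fieldType) (n : nat).

(* Numbered from 1: [bas 1], ..., [bas n] is the standard basis, and [bas k]
   is 0 for every other k. *)
Definition bas (k : nat) : 'rV[F]_n := \row_(j < n) (j.+1 == k)%:R.

(* The algebra on F^n whose i-th and j-th basis vectors (1 <= i, j <= n) have
   product [T i j]. *)
Definition alg_of_table (T : nat -> nat -> 'rV[F]_n) : alg 'rV[F]_n :=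
  linfun (fun x : 'rV[F]_n => linfun (fun y : 'rV[F]_n =>
    \sum_(i < n) \sum_(j < n) (x 0 i * y 0 j) *: T i.+1 j.+1)).

Lemma alg_of_tableE T x y :
  alg_of_table T x y =
  \sum_(i < n) \sum_(j < n) (x 0 i * y 0 j) *: T i.+1 j.+1.
Proof.
pose h (x y : 'rV[F]_n) :=
  \sum_(i < n) \sum_(j < n) (x 0 i * y 0 j) *: T i.+1 j.+1.
have lin2 u : linear (h u).
  move=> a v w; rewrite /h /= scaler_sumr -big_split /=; apply: eq_bigr => i _.
  rewrite scaler_sumr -big_split /=; apply: eq_bigr => j _.
  by rewrite !mxE mulrDr scalerDl scalerA mulrCA.
pose g u : {linear 'rV[F]_n -> 'rV[F]_n} :=
  HB.pack (h u) (GRing.isLinear.Build _ _ _ _ _ (lin2 u)).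
have lin1 : linear (fun u => linfun (g u)).
  move=> a v w; apply/lfunP => z; rewrite add_lfunE scale_lfunE !lfunE /= /h.
  rewrite scaler_sumr -big_split /=; apply: eq_bigr => i _.
  rewrite scaler_sumr -big_split /=; apply: eq_bigr => j _.
  by rewrite !mxE mulrDl scalerDl scalerA mulrA.
pose f : {linear 'rV[F]_n -> 'Hom('rV[F]_n, 'rV[F]_n)} :=
  HB.pack (fun u => linfun (g u)) (GRing.isLinear.Build _ _ _ _ _ lin1).
rewrite /alg_of_table -[X in linfun X]/(f : _ -> _) lfunE /=.
by rewrite (lfunE (g x)).
Qed.

Lemma alg_of_table_bas T (i j : 'I_n) :
  alg_of_table T (bas i.+1) (bas j.+1) = T i.+1 j.+1.
Proof.
rewrite alg_of_tableE (bigD1 i) //= [X in _ + X]big1 => [|k kNi].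
  rewrite (bigD1 j) //= [X in _ + X + _]big1 => [|k kNj].
    by rewrite !mxE !eqxx mul1r scale1r !addr0.
  by rewrite !mxE !eqSS !(inj_eq val_inj) (negPf kNj) mulr0 scale0r.
by apply: big1 => m _;
  rewrite !mxE !eqSS !(inj_eq val_inj) (negPf kNi) mul0r scale0r.
Qed.

(* L4_a a and L5_a are the direct sums of L_4(a), resp. L_5, with the abelian
   algebra of dimension n - 3; they are meaningful only for 3 <= n. *)
Definition L4_a (a : F) : alg 'rV[F]_n :=
  alg_of_table (fun i j =>
    match i, j with
    | 1%N, 1%N => bas 3
    | 2%N, 1%N => bas 3
    | 2%N, 2%N => a *: bas 3
    | _, _ => 0
    end).

Definition L5_a : alg 'rV[F]_n :=
  alg_of_table (fun i j =>
    match i, j with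
    | 1%N, 1%N => bas 3
    | 1%N, 2%N => bas 3
    | 2%N, 1%N => bas 3
    | _, _ => 0
    end).

Definition r_alg : alg 'rV[F]_n :=
  alg_of_table (fun i j => if (2 <= i <= n)%N && (j == 1)%N then bas i else 0).

End Tables.

Arguments L4_a {F} n a.
Arguments L5_a F n : clear implicits.
Arguments r_alg F n : clear implicits.

(* Main.v *)
Require Import Defs.
From HB Require Import structures.
From mathcomp Require Import all_boot all_order all_algebra.
From mathcomp Require Import reals complex.
From mathcomp Require Import boolp mpoly ring.
Set Implicit Arguments.
Unset Strict Implicit.
Unset Printing Implicit Defensive.
Import GRing.Theory Num.Theory.
Local Open Scope ring_scope.

(** Let [L -> M -> 0] be a chain of direct degenerations, [L] a Leibniz algebra
    that is not Lie.

    The tool is a family of explicit degenerations.  Take independent [x], [y]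
    and a functional [f] that vanishes on both, and read the product off the
    plane they span: this gives a 2 x 2 matrix with entries [f (xx)], [f (xy)],
    [f (yx)], [f (yy)].  Scaling [x], [y] by [t ^ 2], a vector [z] with
    [f z = 1] by [t ^ 4] and the rest of a basis adapted to [f] by [t ^ 3] makes
    every other structure constant vanish as [t] goes to 0, so any algebra
    degenerates to the algebra [e_i e_j = b_ij e_3] of that matrix
    ([degenerates_form_table]).  Up to scaling and congruence a matrix with
    [b_11 <> 0] is, if it is not symmetric, the one of [L_4 a] with
    [a = det b / (b_12 - b_21) ^ 2] ([degenerates_L4]), and, if it is symmetric
    and invertible, the one of [L_5] ([degenerates_L5]).

    Suppose first that all these matrices are symmetric and singular.  This
    determines a Leibniz algebra ([leibniz_squarelike_off]): either it is [r_n],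
    or its product is [xy = f(x) f(y) z].  The second form is preserved by
    degeneration to nonzero algebras, so that [M] would be isomorphic to [L].

    Otherwise [L] degenerates to some [N] among the [L_4 a] and [L_5]
    ([leibniz_degenerates_L4_L5]); this uses that two conditions which hold for
    some plane and functional hold for a common one ([nonvanishing_mul]).  As
    [M -> 0] is direct, [M] is isomorphic to each of its nonzero degenerations.
    - If [M] is not Lie, it is therefore the algebra [e_1 e_1 = e_3], to which
      [N] degenerates too; as [L -> M] is direct, [L] is isomorphic to [N].
    - If [M] is Lie, a square of [L] is a nonzero vector that every left
      multiplication kills, and having one is a closed condition, so [M] has
      one.  This excludes [xy = phi(y) x - phi(x) y] and leaves for [M] only the
      Heisenberg algebra [e_1 e_2 = - e_2 e_1 = e_3].  Now [L_4 (1/4)] lies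
      between [L] and [M]: if [L] did not degenerate to it, the quotient
      [det b / (b_12 - b_21) ^ 2] would take finitely many values on [L], all
      different from 1/4, and that closed condition fails on the Heisenberg
      algebra, where the quotient is 1/4 ([degenerates_L4_quarter]).  Hence [L]
      is isomorphic to [L_4 (1/4)]. *)

(** * Linear functionals and products *)

Lemma lfun_exists (F : fieldType) (V W : vectType F) (h : V -> W) :
  linear h -> exists f : 'Hom(V, W), f =1 h.
Proof.
move=> lin; pose h' : {linear V -> W} :=
  HB.pack h (GRing.isLinear.Build _ _ _ _ _ lin).
by exists (linfun h') => x; rewrite lfunE.
Qed.

Lemma size_full_basis (F : fieldType) (V : vectType F) (s : seq V) :
  basis_of {:V} s -> size s = \dim {:V}.
Proof.
move=> bs; apply/eqP; rewrite eqn_leq; move: (bs) (bs).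
by rewrite {1}basisEdim basisEfree => /andP[_ ->] /and3P[].
Qed.

(** Turns a linear combination of known equations into the goal: what is left
    is an identity, within reach of [ring] or [field] (for vectors, after
    [dual_ext]). *)
Lemma shift_eq (V : zmodType) (c d a b : V) : c = d -> a - b = c - d -> a = b.
Proof. by move=> -> ab; apply/eqP; rewrite -subr_eq0 ab subrr. Qed.

Section Linear.
Variables (F : fieldType) (V : vectType F).
Implicit Types (f g : 'Hom(V, F^o)) (L : alg V) (u v w x y z : V) (a : F).

Lemma dualD f u v : f (u + v) = f u + f v :> F. Proof. by rewrite linearD. Qed.
Lemma dualN f u : f (- u) = - f u :> F. Proof. by rewrite linearN. Qed.
Lemma dualZ f a u : f (a *: u) = a * f u :> F. Proof. by rewrite linearZ. Qed.
Lemma dual0 f : f 0 = 0 :> F. Proof. by rewrite linear0. Qed.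
Lemma dualDf f g u : (f + g) u = f u + g u :> F. Proof. by rewrite add_lfunE. Qed.
Lemma dualZf f a u : (a *: f) u = a * f u :> F. Proof. by rewrite scale_lfunE. Qed.
Definition dualE := (dualD, dualN, dualZ, dual0, dualDf, dualZf).

Lemma amulDl L u v w : L (u + v) w = L u w + L v w.
Proof. by rewrite linearD add_lfunE. Qed.
Lemma amulDr L u v w : L u (v + w) = L u v + L u w.
Proof. exact: linearD. Qed.
Lemma amulNl L u v : L (- u) v = - L u v.
Proof. by rewrite linearN opp_lfunE. Qed.
Lemma amulNr L u v : L u (- v) = - L u v.
Proof. exact: linearN. Qed.
Lemma amulZl L a u v : L (a *: u) v = a *: L u v.
Proof. by rewrite linearZ /= scale_lfunE. Qed.
Lemma amulZr L a u v : L u (a *: v) = a *: L u v.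
Proof. exact: linearZ. Qed.
Lemma amul0l L u : L 0 u = 0.
Proof. by rewrite linear0 zero_lfunE. Qed.
Lemma amul0r L u : L u 0 = 0.
Proof. exact: linear0. Qed.
Definition amulE := (amulDl, amulDr, amulNl, amulNr, amulZl, amulZr, amul0l, amul0r).

Lemma separate (U : {vspace V}) v : v \notin U ->
  exists2 f : 'Hom(V, F^o), (forall u, u \in U -> f u = 0 :> F) & f v = 1 :> F.
Proof.
move=> vU; pose w := v - projv U v.
have w0 : w != 0.
  apply: contraNneq vU => /eqP; rewrite subr_eq0 => /eqP vE.
  by rewrite vE memv_proj.
pose h x : F := coord [tuple w] ord0 (x - projv U x).
have [f fE] : exists f : 'Hom(V, F^o), f =1 h.
  apply: lfun_exists => a x y; rewrite /h.
  have -> : a *: x + y - projv U (a *: x + y) =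
            a *: (x - projv U x) + (y - projv U y).
    by rewrite linearP scalerBr opprD addrACA.
  by rewrite linearP.
exists f => [u uU|]; first by rewrite fE /h projv_id // subrr linear0.
by rewrite fE /h; apply: (coord_free (X := [tuple w]) ord0 ord0); rewrite seq1_free.
Qed.

(** Reduces identities between vectors to identities in the field. *)
Lemma dual_ext u v : (forall f, f u = f v) -> u = v.
Proof.
move=> uv; apply/eqP; rewrite -subr_eq0 -memv0; apply/negPn/negP => /separate[f _].
by rewrite !dualE uv subrr => /eqP; rewrite eq_sym oner_eq0.
Qed.

End Linear.

(** * Coordinates of an algebra *)

Section Tensor.
Variables (F : fieldType) (V : vectType F).
Implicit Types (f g : 'Hom(V, F^o)) (L : alg V) (u v w x y z : V) (a : F).

(** The elementary tensors [f (x) g (x) v], which span the space of products. *)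
Definition tensor f g v : alg V :=
  linfun (fun x : V => linfun (fun y : V => (f x * g y) *: v)).

Lemma tensorE f g v x y : tensor f g v x y = (f x * g y) *: v.
Proof.
have lin2 z : linear (fun y : V => (f z * g y) *: v).
  by move=> a y1 y2; rewrite !dualE mulrDr mulrCA scalerDl scalerA.
pose h z : {linear V -> V} :=
  HB.pack (fun y : V => (f z * g y) *: v) (GRing.isLinear.Build _ _ _ _ _ (lin2 z)).
have lin1 : linear (fun z => linfun (h z)).
  move=> a z1 z2; apply/lfunP => z; rewrite add_lfunE scale_lfunE !lfunE /=.
  by rewrite !dualE mulrDl -mulrA scalerDl scalerA.
pose k : {linear V -> 'Hom(V, V)} :=
  HB.pack (fun z => linfun (h z)) (GRing.isLinear.Build _ _ _ _ _ lin1).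
by rewrite /tensor -[X in linfun X]/(k : _ -> _) lfunE /= (lfunE (h x)).
Qed.

Lemma alg_ext L L' : (forall x y, L x y = L' x y) -> L = L'.
Proof. by move=> LL'; apply/lfunP => x; apply/lfunP => y; apply: LL'. Qed.

Lemma alg_sumE (I : Type) (r : seq I) (P : pred I) (G : I -> alg V) x y :
  (\sum_(i <- r | P i) G i) x y = \sum_(i <- r | P i) G i x y.
Proof. by rewrite sum_lfunE sum_lfunE. Qed.

Lemma dual_sum f (I : Type) (r : seq I) (P : pred I) (G : I -> V) :
  f (\sum_(i <- r | P i) G i) = \sum_(i <- r | P i) f (G i) :> F.
Proof. by rewrite linear_sum. Qed.

Section Basis.
Variables (n : nat) (X : n.-tuple V).
Hypothesis basisX : basis_of fullv X.

Definition cdual (i : 'I_n) : 'Hom(V, F^o) := linfun (coord X i : V -> F^o).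

Lemma cdualE i x : cdual i x = coord X i x.
Proof. by rewrite lfunE. Qed.

Lemma cdual_basis (i j : 'I_n) : cdual i X`_j = (i == j)%:R :> F.
Proof. by rewrite cdualE coord_free ?(basis_free basisX) // eq_sym. Qed.

Lemma basis_sum x : x = \sum_i cdual i x *: X`_i.
Proof.
rewrite {1}(coord_basis basisX (memvf x)).
by apply: eq_bigr => i _; rewrite cdualE.
Qed.

Lemma mul_basis L x y :
  L x y = \sum_i \sum_j (cdual i x * cdual j y) *: L X`_i X`_j.
Proof.
rewrite {1}(basis_sum x) linear_sum sum_lfunE; apply: eq_bigr => i _.
rewrite amulZl {1}(basis_sum y) linear_sum scaler_sumr.
by apply: eq_bigr => j _; rewrite linearZ scalerA.
Qed.

Lemma alg_basis L :
  L = \sum_i \sum_j tensor (cdual i) (cdual j) (L X`_i X`_j).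
Proof.
apply: alg_ext => x y; rewrite mul_basis alg_sumE; apply: eq_bigr => i _.
by rewrite alg_sumE; apply: eq_bigr => j _; rewrite tensorE.
Qed.

Lemma dual_alg_eval (l : 'Hom(alg V, F^o)) L :
  l L = \sum_(i < n) \sum_(j < n) \sum_(k < n)
    cdual k (L X`_i X`_j) * l (tensor (cdual i) (cdual j) X`_k) :> F.
Proof.
rewrite {1}(alg_basis L) linear_sum; apply: eq_bigr => i _.
rewrite linear_sum; apply: eq_bigr => j _.
have -> : tensor (cdual i) (cdual j) (L X`_i X`_j) =
   \sum_k cdual k (L X`_i X`_j) *: tensor (cdual i) (cdual j) X`_k.
  apply: alg_ext => x y; rewrite tensorE alg_sumE {1}(basis_sum (L X`_i X`_j)) scaler_sumr.
  apply: eq_bigr => k _; rewrite scale_lfunE scale_lfunE tensorE !scalerA.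
  by rewrite mulrC.
by rewrite linear_sum; apply: eq_bigr => k _; rewrite linearZ.
Qed.

End Basis.

End Tensor.

(** * Polynomial functions and the Zariski closure *)

Section Polynomial.
Variable F : fieldType.

(** Polynomial functions rather than polynomials, so that composite expressions
    need not be named. *)
Definition upoly (h : F -> F) := exists p : {poly F}, forall t, h t = p.[t].

Lemma upoly_ext h k : h =1 k -> upoly k -> upoly h.
Proof. by move=> hk [p kE]; exists p => t; rewrite hk. Qed.
Lemma upolyC a : upoly (fun=> a).
Proof. by exists a%:P => t; rewrite hornerC. Qed.
Lemma upolyX : upoly id.
Proof. by exists 'X => t; rewrite hornerX. Qed.
Lemma upolyD h k : upoly h -> upoly k -> upoly (fun t => h t + k t).
Proof. by move=> [p hE] [q kE]; exists (p + q) => t; rewrite hornerD hE kE. Qed.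
Lemma upolyN h : upoly h -> upoly (fun t => - h t).
Proof. by move=> [p hE]; exists (- p) => t; rewrite hornerN hE. Qed.
Lemma upolyM h k : upoly h -> upoly k -> upoly (fun t => h t * k t).
Proof. by move=> [p hE] [q kE]; exists (p * q) => t; rewrite hornerM hE kE. Qed.
Lemma upolyXn h n : upoly h -> upoly (fun t => h t ^+ n).
Proof. by move=> [p hE]; exists (p ^+ n) => t; rewrite horner_exp hE. Qed.
Lemma upoly_sum (I : Type) (r : seq I) (P : pred I) (h : I -> F -> F) :
  (forall i, upoly (h i)) -> upoly (fun t => \sum_(i <- r | P i) h i t).
Proof.
move=> hP; elim: r => [|i r IH].
  by apply: upoly_ext (upolyC 0) => t; rewrite big_nil.
case: (boolP (P i)) => Pi.
  by apply: upoly_ext (upolyD (hP i) IH) => t; rewrite big_cons Pi.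
by apply: upoly_ext IH => t; rewrite big_cons (negPf Pi).
Qed.
Lemma upoly_prod (I : Type) (r : seq I) (h : I -> F -> F) :
  (forall i, upoly (h i)) -> upoly (fun t => \prod_(i <- r) h i t).
Proof.
move=> hP; elim: r => [|i r IH].
  by apply: upoly_ext (upolyC 1) => t; rewrite big_nil.
by apply: upoly_ext (upolyM (hP i) IH) => t; rewrite big_cons.
Qed.

Variable E : vectType F.
Implicit Types (q : E -> F) (c : F -> E).

Definition polyfun q := exists p, forall x, q x = peval p x.

Lemma polyfun_ext q r : q =1 r -> polyfun r -> polyfun q.
Proof. by move=> qr [p rE]; exists p => x; rewrite qr. Qed.
Lemma polyfunC a : polyfun (fun=> a).
Proof. by exists a%:MP => x; rewrite /peval mevalC. Qed.
Lemma polyfunD q r : polyfun q -> polyfun r -> polyfun (fun x => q x + r x).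
Proof. by move=> [p qE] [s rE]; exists (p + s) => x; rewrite /peval mevalD qE rE. Qed.
Lemma polyfunN q : polyfun q -> polyfun (fun x => - q x).
Proof. by move=> [p qE]; exists (- p) => x; rewrite /peval mevalN qE. Qed.
Lemma polyfunM q r : polyfun q -> polyfun r -> polyfun (fun x => q x * r x).
Proof. by move=> [p qE] [s rE]; exists (p * s) => x; rewrite /peval mevalM qE rE. Qed.
Lemma polyfun_sum (I : Type) (r : seq I) (P : pred I) (h : I -> E -> F) :
  (forall i, polyfun (h i)) -> polyfun (fun t => \sum_(i <- r | P i) h i t).
Proof.
move=> hP; elim: r => [|i r IH].
  by apply: polyfun_ext (polyfunC 0) => t; rewrite big_nil.
case: (boolP (P i)) => Pi.
  by apply: polyfun_ext (polyfunD (hP i) IH) => t; rewrite big_cons Pi.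
by apply: polyfun_ext IH => t; rewrite big_cons (negPf Pi).
Qed.
Lemma polyfun_prod (I : Type) (r : seq I) (h : I -> E -> F) :
  (forall i, polyfun (h i)) -> polyfun (fun t => \prod_(i <- r) h i t).
Proof.
move=> hP; elim: r => [|i r IH].
  by apply: polyfun_ext (polyfunC 1) => t; rewrite big_nil.
by apply: polyfun_ext (polyfunM (hP i) IH) => t; rewrite big_cons.
Qed.
Lemma polyfun_det n (A : E -> 'M[F]_n) :
  (forall i j, polyfun (fun x => A x i j)) -> polyfun (fun x => \det (A x)).
Proof.
move=> Ap; rewrite /determinant; apply: polyfun_sum => s.
by apply: polyfunM; [apply: polyfunC | apply: polyfun_prod].
Qed.

Lemma polyfun_dual (l : 'Hom(E, F^o)) : polyfun (fun x => l x).
Proof.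
pose X := vbasis (fullv : {vspace E}); have bX : basis_of fullv X := vbasisP _.
exists (\sum_(i < \dim {:E}) (l X`_i : F) *: 'X_i) => x; rewrite /peval.
rewrite {1}(basis_sum bX x) linear_sum raddf_sum /=.
by apply: eq_bigr => i _; rewrite linearZ mevalZ mevalXU /= cdualE [RHS]mulrC.
Qed.

(** Testing against all functionals makes the notion stable under linear maps,
    in particular under the action of GL. *)
Definition polycurve c := forall l : 'Hom(E, F^o), upoly (fun t => l (c t)).

Lemma peval_curve c p : polycurve c -> upoly (fun t => peval p (c t)).
Proof.
move=> cP; rewrite /peval.
apply: (upoly_ext (fun t => mevalE _ p)).
apply: upoly_sum => m; apply: upolyM; first exact: upolyC.
apply: upoly_prod => i; apply: upolyXn.
by apply: upoly_ext (cP (cdual (vbasis {:E}) i)) => t; rewrite cdualE.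
Qed.

Lemma closure_polyfun (S : E -> Prop) q x : polyfun q ->
  (forall y, S y -> q y = 0) -> zariski_closure S x -> q x = 0.
Proof.
move=> [p qE] Sq /(_ (fun y => q y = 0)); apply => //.
exists (eq p) => y; split; first by move=> q0 r <-; rewrite -qE.
by rewrite qE; apply.
Qed.

Lemma in_closure (S : E -> Prop) x :
  (forall q, polyfun q -> (forall y, S y -> q y = 0) -> q x = 0) ->
  zariski_closure S x.
Proof.
move=> H Z [P ZP] SZ; apply/ZP => p Pp.
by apply: (H (peval p)) => [|y /SZ /ZP]; [exists p | apply].
Qed.

Lemma sub_closure (S : E -> Prop) x : S x -> zariski_closure S x.
Proof. by move=> Sx; apply: in_closure => q _; apply. Qed.

End Polynomial.

(** The product of two nonzero polynomials is nonzero and has finitely many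
    roots, whereas the field is infinite. *)
Lemma upoly_inf_mul (F : numFieldType) (h k : F -> F) : upoly h -> upoly k ->
  (exists t, h t != 0) -> (exists t, k t != 0) -> exists t, h t * k t != 0.
Proof.
move=> [p hE] [q kE] [t ht] [u ku]; apply: contrapT => hk.
have : p * q = 0.
  have hk0 : forall t, h t * k t = 0.
    by move=> s; apply/eqP; apply: contrapT => /negP ?; apply: hk; exists s.
  apply/eqP; apply: contraT => pq0.
  pose s : seq F := [seq i%:R | i <- iota 0 (size (p * q))].
  have us : uniq s.
    rewrite map_inj_uniq ?iota_uniq // => i j /eqP.
    by rewrite Num.Theory.eqr_nat => /eqP.
  suff : (size s < size (p * q)%R)%N by rewrite size_map size_iota ltnn.
  apply: max_poly_roots => //; apply/allP => _ /mapP[i _ ->].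
  by rewrite /root hornerM -hE -kE hk0.
move/eqP; rewrite mulf_eq0 => /orP[] /eqP p0.
  by move: ht; rewrite hE p0 horner0 eqxx.
by move: ku; rewrite kE p0 horner0 eqxx.
Qed.

Lemma upoly_inf (F : numFieldType) (h : F -> F) : upoly h ->
  (forall t, t != 0 -> h t = 0) -> forall t, h t = 0.
Proof.
move=> hP h0 t; apply/eqP; apply: contrapT => /negP ht.
have [||u] := @upoly_inf_mul F h id hP (upolyX F); first by exists t.
  by exists 1; rewrite oner_eq0.
by have [->|/h0 ->] := eqVneq u 0; rewrite ?mulr0 ?mul0r eqxx.
Qed.

(** * Isomorphisms and degenerations along curves *)

Section Iso.
Variables (F : fieldType).
Implicit Types (U V W : vectType F).

Lemma iso_refl V (L : alg V) : isomorphic L L.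
Proof. by exists \1%VF => [|x y]; [exists id => x; rewrite lfunE | rewrite !lfunE]. Qed.

Lemma iso_sym V W (L : alg V) (M : alg W) : isomorphic L M -> isomorphic M L.
Proof.
move=> [f [g fK gK] fM].
have [k kE] : exists k : 'Hom(W, V), k =1 g.
  apply: lfun_exists => a u v; apply: (can_inj fK).
  by rewrite /= gK linearP /= !gK.
exists k; first by exists f => x; rewrite kE ?fK ?gK.
by move=> x y; apply: (can_inj fK); rewrite fM !kE !gK.
Qed.

Lemma iso_trans U V W (L : alg U) (M : alg V) (N : alg W) :
  isomorphic L M -> isomorphic M N -> isomorphic L N.
Proof.
move=> [f bf fM] [g bg gM]; exists (g \o f)%VF.
  by apply: (eq_bij (bij_comp bg bf)) => x; rewrite lfunE.
by move=> x y; rewrite !comp_lfunE fM gM.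
Qed.

(** Reduces an isomorphism with a multiplication table to the computation of
    structure constants in one adapted basis. *)
Lemma iso_table V n (X : n.-tuple V) (L : alg V)
    (T : nat -> nat -> 'rV[F]_n) : basis_of fullv X ->
  (forall i j k : 'I_n, cdual X k (L X`_i X`_j) = T i.+1 j.+1 0 k :> F) ->
  isomorphic L (alg_of_table T).
Proof.
move=> bX LT; pose h (x : V) : 'rV[F]_n := \row_i cdual X i x.
have [f fE] : exists f : 'Hom(V, 'rV[F]_n), f =1 h.
  by apply: lfun_exists => a u v; apply/rowP => i; rewrite !mxE !dualE.
exists f.
  exists (fun v : 'rV[F]_n => \sum_(i < n) v 0 i *: X`_i) => v.
    by rewrite fE [RHS](basis_sum bX v); apply: eq_bigr => i _; rewrite mxE.
  rewrite fE; apply/rowP => i; rewrite mxE cdualE.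
  by rewrite coord_sum_free ?(basis_free bX).
move=> x y; rewrite !fE alg_of_tableE; apply/rowP => k; rewrite mxE.
rewrite (mul_basis bX) dual_sum summxE; apply: eq_bigr => i _.
rewrite dual_sum summxE; apply: eq_bigr => j _.
by rewrite dualE LT !mxE.
Qed.

End Iso.

Section Degen.
Variables (F : numFieldType) (V : vectType F).
Implicit Types (L M : alg V).

(** How an equation satisfied by the isomorphism class of [L] is inherited by
    the degenerations of [L]. *)
Lemma degenerates_closed L M (q : alg V -> F) : polyfun q -> degenerates L M ->
  (forall L', isomorphic L L' -> q L' = 0) -> q M = 0.
Proof.
move=> qP /(_ M) LM Lq; apply: (closure_polyfun qP _ (LM _)).
  by move=> L' /orbitP; apply: Lq.
exact/orbitP/iso_refl.
Qed.

Lemma degenerates_iso L M M' : degenerates L M -> isomorphic M M' -> degenerates L M'.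
Proof.
move=> LM MM' N /orbitP M'N; apply: LM; apply/orbitP.
exact: iso_trans MM' M'N.
Qed.

Lemma iso_degenerates L M : isomorphic L M -> degenerates L M.
Proof.
move=> LM N /orbitP MN; apply: sub_closure; apply/orbitP; exact: iso_trans MN.
Qed.

Lemma gact_linear g : linear (@gact F V g).
Proof.
move=> a L M; apply: alg_ext => x y.
rewrite !(gactE, add_lfunE, scale_lfunE) /=.
by rewrite linearP.
Qed.

Lemma polycurve_gact g c : polycurve c -> polycurve (fun t => @gact F V g (c t)).
Proof.
move=> cP l.
have [k kE] : exists k : 'Hom(alg V, F^o), k =1 (fun L => l (gact g L)).
  by apply: lfun_exists => a L M; rewrite gact_linear linearP.
by apply: upoly_ext (cP k) => t; rewrite kE.
Qed.

(** The values [c t x y] determine all coordinates of [c t] linearly. *)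
Lemma polycurve_eval (c : F -> alg V) :
  (forall (f : 'Hom(V, F^o)) x y, upoly (fun t => f (c t x y))) -> polycurve c.
Proof.
move=> cP l; apply: (upoly_ext (fun t => dual_alg_eval (vbasisP fullv) l (c t))).
apply: upoly_sum => i; apply: upoly_sum => j; apply: upoly_sum => k.
by apply: upolyM => //; apply: upolyC.
Qed.

(** A polynomial in [t] that vanishes for [t <> 0] vanishes at 0; acting by [g]
    moves the whole curve inside the orbits. *)
Lemma degenerates_curve L c : polycurve c ->
  (forall t, t != 0 -> degenerates L (c t)) -> degenerates L (c 0).
Proof.
move=> cP Lc M [g gl_g ->]; apply: in_closure => q [p qE] Lq; rewrite qE.
apply: (upoly_inf (h := fun t => peval p (gact g (c t)))).
  exact/peval_curve/polycurve_gact.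
move=> t t0; rewrite -qE; apply: (closure_polyfun (ex_intro _ p qE) Lq).
by apply: (Lc t t0); exists g.
Qed.

(** The curve is [t *: L], which the homothety of ratio [t] identifies with [L]. *)
Lemma degenerates0 L : degenerates L 0.
Proof.
pose c t := t *: L; rewrite -[0](scale0r L) -/(c 0); apply: degenerates_curve.
  apply: polycurve_eval => f x y.
  apply: (upoly_ext (k := fun t => t * f (L x y))).
    by move=> t; rewrite /c !scale_lfunE dualE.
  by apply: upolyM; [apply: upolyX | apply: upolyC].
move=> t t0; apply: iso_degenerates; apply: iso_sym; exists (t *: \1%VF).
  by exists (fun x => t^-1 *: x) => x;
    rewrite scale_lfunE lfunE scalerA ?mulVf ?mulfV ?scale1r.
by move=> x y; rewrite !scale_lfunE !lfunE /= !amulE.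
Qed.

End Degen.

Section HyperplaneBasis.
Variables (F : fieldType) (V : vectType F).

Lemma free_basis (s : seq V) (U : {vspace V}) : free s -> {subset s <= U} ->
  exists2 r, basis_of U (s ++ r) & {subset r <= U}.
Proof.
move=> fs /span_subvP sU; exists (vbasis (U :\: <<s>>)%VS).
  have UE : (<<s>> + (U :\: <<s>>) = U)%VS.
    by rewrite addvC addv_diff; apply/addv_idPl.
  rewrite -[X in basis_of X]UE; apply: cat_basis; last exact: vbasisP.
    by apply/directv_addP; rewrite capvC capv_diff.
  by rewrite basisEfree fs subvv /= (eqP fs).
by move=> x /(vbasis_mem); apply/subvP; apply: diffvSl.
Qed.

(** [f] is the coordinate along [z] in such a basis. *)
Lemma hyperplane_basis (f : 'Hom(V, F^o)) z (s : seq V) : f z = 1 :> F ->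
  free s -> (forall x, x \in s -> f x = 0 :> F) ->
  exists2 r, basis_of fullv (z :: s ++ r) & forall x, x \in r -> f x = 0 :> F.
Proof.
move=> fz fs sf.
have [|r br rf] := @free_basis s (lker f) fs.
  by move=> x /sf fx; rewrite memv_ker fx.
exists r; last by move=> x /rf; rewrite memv_ker => /eqP.
have z0 : z != 0.
  by apply: contra_eq_neq fz => ->; rewrite dualE eq_sym oner_eq0.
have -> : fullv = (<[z]> + lker f)%VS.
  apply/eqP; rewrite eqEsubv subvf andbT; apply/subvP => v _.
  rewrite -[v](subrK (f v *: z)) addrC memv_add ?memvZ ?memv_line //.
  by rewrite memv_ker !dualE fz mulr1 subrr.
rewrite -cat1s; apply: cat_basis => //; last first.
  exact: (seq1_basis z0).
apply/directv_addP/eqP; rewrite -subv0; apply/subvP => v.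
rewrite memv_cap => /andP[/vlineP[a ->]]; rewrite memv_ker dualE fz mulr1.
by move=> /eqP ->; rewrite scale0r mem0v.
Qed.

End HyperplaneBasis.

(** * Degeneration to a bilinear form with one-dimensional values *)

(** The common shape of [L4_a] and [L5_a]. *)
Definition form_table (F : fieldType) n (b11 b12 b21 b22 : F) : alg 'rV[F]_n :=
  alg_of_table (fun i j =>
    match i, j with
    | 1%N, 1%N => b11 *: bas F n 3
    | 1%N, 2%N => b12 *: bas F n 3
    | 2%N, 1%N => b21 *: bas F n 3
    | 2%N, 2%N => b22 *: bas F n 3
    | _, _ => 0
    end).

Lemma alg_of_table_ext (F : fieldType) n (T T' : nat -> nat -> 'rV[F]_n) :
  (forall i j, T i j = T' i j) -> alg_of_table T = alg_of_table T'.
Proof.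
move=> TT'; apply: alg_ext => x y; rewrite !alg_of_tableE.
by apply: eq_bigr => i _; apply: eq_bigr => j _; rewrite TT'.
Qed.

Lemma L4E (F : fieldType) n (a : F) : L4_a n a = form_table n 1 0 1 a.
Proof.
by apply: alg_of_table_ext => -[|[|[|i]]] [|[|[|j]]] //; rewrite ?scale1r ?scale0r.
Qed.

Lemma L5E (F : fieldType) n : L5_a F n = form_table n 1 1 1 0.
Proof.
by apply: alg_of_table_ext => -[|[|[|i]]] [|[|[|j]]] //; rewrite ?scale1r ?scale0r.
Qed.

Section Key.
Variables (F : numFieldType) (V : vectType F).
Implicit Types (L M : alg V) (f : 'Hom(V, F^o)).

(** Exponents by which the basis vectors are scaled. The sum of two of them is
    at least 4, hence at least any third one, so that no structure constant gets
    a pole; the sum equals a third weight only as 2 + 2 = 4, so that only the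
    products of the first two basis vectors along the third survive at 0. *)
Definition weight (i : nat) : nat :=
  match i with 0 | 1 => 2 | 2 => 4 | _ => 3 end.

Lemma weight_le i j k : (weight k <= weight i + weight j)%N.
Proof. by case: i => [|[|[|i]]]; case: j => [|[|[|j]]]; case: k => [|[|[|k]]]. Qed.

(** The product obtained from [L] by scaling the [i]-th basis vector by
    [t ^ weight i]. Its structure constants are given directly, which defines it
    at [t = 0] as well. *)
Definition weighted n (X : n.-tuple V) L (t : F) : alg V :=
  \sum_(i < n) \sum_(j < n) tensor (cdual X i) (cdual X j)
    (\sum_(k < n) (t ^+ (weight i + weight j - weight k) *
                   cdual X k (L X`_i X`_j)) *: X`_k).

Section Basis.
Variables (n : nat) (X : n.-tuple V) (L : alg V).
Hypothesis bX : basis_of fullv X.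

Lemma weightedE t x y : weighted X L t x y =
  \sum_(i < n) \sum_(j < n) (cdual X i x * cdual X j y) *:
    (\sum_(k < n) (t ^+ (weight i + weight j - weight k) *
                   cdual X k (L X`_i X`_j)) *: X`_k).
Proof.
rewrite alg_sumE; apply: eq_bigr => i _; rewrite alg_sumE.
by apply: eq_bigr => j _; rewrite tensorE.
Qed.

Lemma weighted_basis t (i j k : 'I_n) : cdual X k (weighted X L t X`_i X`_j) =
  t ^+ (weight i + weight j - weight k) * cdual X k (L X`_i X`_j) :> F.
Proof.
rewrite weightedE (bigD1 i) //= [X in _ + X]big1 ?addr0; last first.
  move=> i' ii'; rewrite big1 // => j' _.
  by rewrite !(cdual_basis bX) (negPf ii') mul0r scale0r.
rewrite (bigD1 j) //= [X in _ + X]big1 ?addr0; last first.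
  by move=> j' jj'; rewrite !(cdual_basis bX) (negPf jj') mulr0 scale0r.
rewrite !(cdual_basis bX) !eqxx mul1r scale1r.
by rewrite cdualE coord_sum_free // (basis_free bX).
Qed.

Lemma weighted_curve : polycurve (weighted X L).
Proof.
apply: polycurve_eval => f x y.
apply: (upoly_ext (k := fun t => \sum_(i < n) \sum_(j < n)
   (cdual X i x * cdual X j y) * \sum_(k < n)
     (t ^+ (weight i + weight j - weight k) * cdual X k (L X`_i X`_j) * f X`_k))).
  move=> t; rewrite weightedE dual_sum; apply: eq_bigr => i _; rewrite dual_sum.
  apply: eq_bigr => j _; rewrite dualE dual_sum; congr (_ * _).
  by apply: eq_bigr => k _; rewrite dualE.
apply: upoly_sum => i; apply: upoly_sum => j; apply: upolyM; first exact: upolyC.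
apply: upoly_sum => k; do 2?[apply: upolyM; last exact: upolyC].
exact/upolyXn/upolyX.
Qed.

Lemma weighted_iso t : t != 0 -> isomorphic L (weighted X L t).
Proof.
move=> t0; apply: iso_sym.
pose h (s : F) (x : V) := \sum_(i < n) (s ^+ weight i * cdual X i x) *: X`_i.
have hlin s : linear (h s).
  move=> a u v; rewrite /h scaler_sumr -big_split /=; apply: eq_bigr => i _.
  by rewrite !dualE scalerA -scalerDl; congr (_ *: _); ring.
have ch s (i : 'I_n) x : cdual X i (h s x) = s ^+ weight i * cdual X i x :> F.
  by rewrite cdualE coord_sum_free // (basis_free bX).
have hK s s' : s * s' = 1 -> cancel (h s) (h s').
  move=> ss' x; rewrite [RHS](basis_sum bX x); apply: eq_bigr => i _.
  by rewrite ch mulrA -exprMn mulrC [s' * s]mulrC ss' expr1n mulr1.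
have [g gE] := lfun_exists (hlin t).
exists g.
  by exists (h t^-1) => x; rewrite gE hK // ?mulfV ?mulVf.
move=> x y; rewrite weightedE (mul_basis bX) linear_sum; apply: eq_bigr => i _.
rewrite linear_sum; apply: eq_bigr => j _ /=.
rewrite linearZ /= !gE !ch.
have -> : h t (\sum_(k < n) (t ^+ (weight i + weight j - weight k) *
     cdual X k (L X`_i X`_j)) *: X`_k) = (t ^+ weight i * t ^+ weight j) *: L X`_i X`_j.
  rewrite [in RHS](basis_sum bX (L X`_i X`_j)) scaler_sumr; apply: eq_bigr => k _.
  rewrite scalerA; congr (_ *: _); rewrite cdualE coord_sum_free ?(basis_free bX) //.
  by rewrite mulrA -!exprD subnKC // weight_le.
by rewrite scalerA; congr (_ *: _); ring.
Qed.

End Basis.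

(** The limit at 0 of [weighted] in a basis [x, y, z, ...] in which [f] is the
    third coordinate. *)
Lemma degenerates_form_table L M f x y : free [:: x; y] ->
  f x = 0 :> F -> f y = 0 :> F -> (exists z, f z != 0 :> F) ->
  isomorphic M (form_table (\dim {:V}) (f (L x x)) (f (L x y)) (f (L y x)) (f (L y y))) ->
  degenerates L M.
Proof.
move=> fxy fx fy [z' fz'] isoM.
pose z := (f z')^-1 *: z'.
have fz : f z = 1 :> F by rewrite dualE mulVf.
have [|r br rf] := hyperplane_basis fz fxy.
  by move=> u; rewrite !inE => /orP[]/eqP->.
have {}br : basis_of fullv (x :: y :: z :: r).
  rewrite -(perm_basis _ (_ : perm_eq (z :: [:: x; y] ++ r) _)) //.
  by apply/permP => a /=; ring.
have sz : size (x :: y :: z :: r) == \dim {:V} by rewrite (size_full_basis br).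
pose X : (\dim {:V}).-tuple V := Tuple sz.
have bX : basis_of fullv X by [].
have X0 : X`_0 = x by []. have X1 : X`_1 = y by []. have X2 : X`_2 = z by [].
have Xf (i : 'I_(\dim {:V})) : f X`_i = (i == 2 :> nat)%:R :> F.
  case: i => -[|[|[|i]]] ltin /=; rewrite ?fx ?fy ?fz //.
  apply: rf; rewrite mem_nth //.
  by move: ltin; rewrite -{1}(eqP sz) /= !ltnS.
have cf (k : 'I_(\dim {:V})) v : k = 2 :> nat -> cdual X k v = f v :> F.
  move=> k2; rewrite [in RHS](basis_sum bX v) dual_sum (bigD1 k) //= big1 ?addr0.
    by rewrite dualE Xf k2 eqxx mulr1.
  by move=> i ik; rewrite dualE Xf -k2 (inj_eq val_inj) (negPf ik) mulr0.
apply: (@degenerates_iso _ _ _ (weighted X L 0)); last first.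
  apply: iso_trans (iso_sym isoM); apply: (iso_table bX) => i j k.
  rewrite (weighted_basis _ bX).
  case: k => -[|[|[|k]]] ltk; case: i => -[|[|[|i]]] lti;
    case: j => -[|[|[|j]]] ltj; rewrite /= ?mxE /= ?expr0n /= ?mulr0 ?mul0r ?mul1r ?mulr1 //.
  1-4: exact: cf.
apply: degenerates_curve => [|t t0]; first exact: weighted_curve.
by apply: iso_degenerates; apply: weighted_iso.
Qed.
End Key.

(** * Algebras with symmetric singular matrices *)

Section Span.
Variables (F : fieldType) (V : vectType F).
Implicit Types (f : 'Hom(V, F^o)) (u v w x y z : V).

Lemma separate_seq (s : seq V) v : v \notin <<s>>%VS ->
  exists2 f : 'Hom(V, F^o), (forall u, u \in s -> f u = 0 :> F) & f v = 1 :> F.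
Proof.
by move=> /separate[f fs fv]; exists f => // u us; apply/fs/memv_span.
Qed.

Lemma span2P x y v : v \in <<[:: x; y]>>%VS -> exists a b, v = a *: x + b *: y.
Proof.
rewrite span_cons span_seq1 => /memv_addP[_ /vlineP[a ->] [_ /vlineP[b ->] ->]].
by exists a, b.
Qed.

Lemma span3P x y z v : v \in <<[:: x; y; z]>>%VS ->
  exists a b c, v = a *: x + b *: y + c *: z.
Proof.
rewrite span_cons => /memv_addP[_ /vlineP[a ->] [_ /span2P[b [c ->]] ->]].
by exists a, b, c; rewrite addrA.
Qed.

Lemma span2_dual x y v :
  (forall f, f x = 0 :> F -> f y = 0 :> F -> f v = 0 :> F) ->
  exists a b, v = a *: x + b *: y.
Proof.
move=> fv; apply: span2P; apply/negPn/negP => /separate_seq[f fs fv1].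
have := fv f (fs _ _) (fs _ _); rewrite !inE !eqxx ?orbT => /(_ isT isT) /eqP.
by rewrite fv1 oner_eq0.
Qed.

Lemma free2P x y :
  (forall a b, a *: x + b *: y = 0 -> a = 0 /\ b = 0) -> free [:: x; y].
Proof.
move=> xy; rewrite free_cons seq1_free span_seq1.
apply/andP; split.
  apply/negP => /vlineP[a xE]; have [] := xy 1 (- a).
    by rewrite xE scale1r scaleNr subrr.
  by move/eqP; rewrite oner_eq0.
apply/negP => /eqP y0; have [] := xy 0 1; first by rewrite y0 scaler0 scale0r addr0.
by move=> _ /eqP; rewrite oner_eq0.
Qed.
End Span.

Section Structure.
Variables (F : numFieldType) (V : vectType F).
Implicit Types (L : alg V) (f : 'Hom(V, F^o)) (u v w x y z : V).

(** Commutativity modulo the span of [x] and [y], by duality. *)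
Definition symmetric_off L := forall f x y,
  f x = 0 :> F -> f y = 0 :> F -> f (L x y) = f (L y x) :> F.

(** When the product is also [symmetric_off], this says that the quadratic form
    [v |-> f (v v)] on the span of [x] and [y] has rank at most one, as it does
    for [xy = g(x) g(y) z]. *)
Definition squarelike_off L := forall f x y, f x = 0 :> F -> f y = 0 :> F ->
  f (L x x) * f (L y y) = f (L x y) ^+ 2 :> F.

Definition right_null L u := forall x, L x u = 0.

Definition square_alg L := exists f x z,
  [/\ f x = 1 :> F, f z = 0 :> F, z != 0 & forall u v, L u v = (f u * f v) *: z].

Lemma two_neq0 : 2 != 0 :> F. Proof. by rewrite pnatr_eq0. Qed.

Lemma double_eq0 v : v + v = 0 -> v = 0.
Proof.
move=> vv; apply: (scalerI two_neq0).
by rewrite scaler0 scaler_nat mulr2n.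
Qed.

Lemma alternating_anti L : (forall x, L x x = 0) -> forall x y, L x y = - L y x.
Proof.
move=> L0 x y; apply/eqP; rewrite -addr_eq0; apply/eqP.
by have := L0 (x + y); rewrite !amulE !L0 add0r addr0.
Qed.

(** The commutator of [x] and [y] lies in their span, and is unchanged when
    [u] is added to [x] or to [y]. If [u] lies outside the span, this forces the
    commutator to be a multiple of [y] and of [x]; if [u] lies inside,
    multiplying it by [x] and by [y] gives a contradiction. *)
Lemma symmetric_off_comm L u : symmetric_off L -> u != 0 ->
  (forall x, L u x = 0) -> right_null L u -> forall x y, L x y = L y x.
Proof.
move=> LJ u0 ul ur x y.
have comb x' y' : exists a b, L x' y' - L y' x' = a *: x' + b *: y'.
  apply: span2_dual => f fx fy.
  by rewrite !dualE (LJ f x' y') // subrr.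
apply/eqP; rewrite -subr_eq0; apply/negPn/negP; set v := _ - _ => v0.
have noncomb p q : u = p *: x + q *: y -> False.
  move=> uE; have := ul y; have := ur y; have := ul x; have := ur x.
  rewrite uE !amulE => xu ux yu uy.
  have /eqP : q *: v = 0.
    apply: (shift_eq (etrans xu (esym ux))).
    by apply: dual_ext => f; rewrite !dualE; ring.
  have /eqP : p *: v = 0.
    apply: (shift_eq (etrans uy (esym yu))).
    by apply: dual_ext => f; rewrite !dualE; ring.
  rewrite !scaler_eq0 (negPf v0) !orbF => /eqP p0 /eqP q0.
  by move: u0; rewrite uE p0 q0 !scale0r addr0 eqxx.
have [a [b vE]] := comb x y; rewrite -/v in vE.
have vy : exists b', v = b' *: y.
  have [a' [b' vE']] := comb (x + u) y.
  rewrite !amulE ul ur !addr0 -/v in vE'.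
  have [a'0|a'0] := eqVneq a' 0.
    by exists b'; rewrite vE' a'0 scale0r add0r.
  exfalso; apply: (@noncomb (a'^-1 * a - 1) (a'^-1 * (b - b'))).
  apply: (scalerI a'0); apply: (shift_eq vE); rewrite vE'; apply: dual_ext => f.
  by rewrite !dualE; field.
have vx : exists a', v = a' *: x.
  have [a' [b' vE']] := comb x (y + u).
  rewrite !amulE ul ur !addr0 -/v in vE'.
  have [b'0|b'0] := eqVneq b' 0.
    by exists a'; rewrite vE' b'0 scale0r addr0.
  exfalso; apply: (@noncomb (b'^-1 * (a - a')) (b'^-1 * b - 1)).
  apply: (scalerI b'0); apply: (shift_eq vE); rewrite vE'; apply: dual_ext => f.
  by rewrite !dualE; field.
case: vy vx => b' vy [a' vx].
have b'0 : b' != 0 by apply: contraNneq v0 => b'0; rewrite vy b'0 scale0r.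
have yE : y = (b'^-1 * a') *: x by rewrite -scalerA -vx vy scalerA mulVf ?scale1r.
by move: v0; rewrite /v yE !amulE subrr eqxx.
Qed.

(** All squares are multiples of [z = x x]: if [y y] were not, functionals
    separating [z] and [y y] would contradict the hypothesis, which is quadratic
    in the functional. By polarization [L x v = f v *: z] for some functional
    [f]; the kernel of [f] then has zero squares, by the same hypothesis
    applied to [x] and an element of the kernel. *)
Lemma squarelike_off_square L : (forall x y, L x y = L y x) ->
  (forall x y z, L x (L y z) = 0) -> squarelike_off L -> (exists x, L x x != 0) ->
  square_alg L.
Proof.
move=> Lc Lnil LD [x]; set z := L x x => z0.
have zr u : L u z = 0 by apply: Lnil.
have squares y : exists c, L y y = c *: z.
  apply: contrapT => yyz.
  (* the premises are what a relation a x + b y + ... = 0, with right null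
     remaining terms, gives when multiplied by x and by y; solving them with
     b <> 0 would make y y a multiple of z *)
  have relation a b : a *: z + b *: L x y = 0 -> a *: L x y + b *: L y y = 0 ->
      a = 0 /\ b = 0.
    move=> h1 h2; suff b0 : b = 0.
      split=> //; move/eqP: h1; rewrite b0 scale0r addr0 scaler_eq0 (negPf z0) orbF.
      by move/eqP.
    apply: contrapT => /eqP b0; apply: yyz; exists ((a / b) ^+ 2).
    apply: (scalerI b0); apply: (shift_eq h2).
    have -> : L x y = - (a / b) *: z.
      apply: (scalerI b0); apply: (shift_eq h1).
      by apply: dual_ext => f; rewrite !dualE; field.
    by apply: dual_ext => f; rewrite !dualE; field.
  have [|f2 f2k f2y] := @separate_seq _ _ [:: x; y; z] (L y y).
    apply/negP => /span3P[a [b [c yyE]]].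
    have abz u : a *: L u x + b *: L u y = 0.
      by have := Lnil u y y; rewrite {1}yyE !amulE zr scaler0 addr0.
    have h := abz y; rewrite (Lc y x) in h.
    have [a0 b0] := relation a b (abz x) h.
    by apply: yyz; exists c; rewrite yyE a0 b0 !scale0r !add0r.
  have [|f1 f1k f1z] := @separate_seq _ _ [:: x; y; L y y] z.
    apply/negP => /span3P[a [b [c zE]]].
    have abz u : a *: L u x + b *: L u y = 0.
      by have := zr u; rewrite {1}zE !amulE Lnil scaler0 addr0.
    have h := abz y; rewrite (Lc y x) in h.
    have [a0 b0] := relation a b (abz x) h.
    move: zE; rewrite a0 b0 !scale0r !add0r => zE.
    have c0 : c != 0 by apply: contraNneq z0 => c0; rewrite zE c0 scale0r.
    by apply: yyz; exists c^-1; rewrite {1}zE scalerA mulVf // scale1r.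
  have [f1x f1y f1yy] : [/\ f1 x = 0 :> F, f1 y = 0 :> F & f1 (L y y) = 0 :> F].
    by split; apply: f1k; rewrite !inE eqxx ?orbT.
  have [f2x f2y' f2z] : [/\ f2 x = 0 :> F, f2 y = 0 :> F & f2 z = 0 :> F].
    by split; apply: f2k; rewrite !inE eqxx ?orbT.
  have /eqP := LD f1 x y f1x f1y; rewrite f1yy mulr0 eq_sym expf_eq0 /= => /eqP g1.
  have /eqP := LD f2 x y f2x f2y'; rewrite -/z f2z mul0r eq_sym expf_eq0 /= => /eqP g2.
  have := LD (f1 + f2) x y; rewrite -/z !dualE f1x f1y f2x f2y' f1z f2z f1yy f2y g1 g2.
  by rewrite !addr0 add0r mulr1 expr0n => /(_ erefl erefl)/eqP; rewrite oner_eq0.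
have products u v : exists c, L u v = c *: z.
  have [a aE] := squares (u + v); have [b bE] := squares u; have [c cE] := squares v.
  exists ((a - b - c) / 2); apply: (scalerI two_neq0); apply: (shift_eq aE).
  rewrite !amulE bE cE (Lc v u); apply: dual_ext => f; rewrite !dualE.
  by field.
have [|g _ gz] := @separate_seq _ _ [::] z; first by rewrite span_nil memv0.
pose f := (g \o L x)%VF; have fE u : f u = g (L x u) by rewrite lfunE.
have xE u : L x u = f u *: z.
  by have [c cE] := products x u; rewrite fE cE dualE gz mulr1.
have fx : f x = 1 :> F by rewrite fE.
have fz : f z = 0 :> F by rewrite fE zr dualE.
have kernel y : f y = 0 :> F -> L y y = 0.
  move=> fy; have xy : L x y = 0 by rewrite xE fy scale0r.
  apply/eqP; apply: contraT => yy0; have [b bE] := squares y.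
  have b0 : b != 0 by apply: contraNneq yy0 => b0; rewrite bE b0 scale0r.
  have [|h hk hz] := @separate_seq _ _ [:: x; y] z.
    apply/negP => /span2P[a [c zE]]; have := zr x; rewrite {1}zE !amulE xy -/z.
    rewrite scaler0 addr0 => /eqP; rewrite scaler_eq0 (negPf z0) orbF => /eqP a0.
    have := zr y; rewrite {1}zE !amulE a0 scale0r add0r => /eqP.
    rewrite scaler_eq0 (negPf yy0) orbF => /eqP c0.
    by move: z0; rewrite zE a0 c0 !scale0r addr0 eqxx.
  have hx : h x = 0 :> F by apply: hk; rewrite !inE eqxx.
  have hy : h y = 0 :> F by apply: hk; rewrite !inE eqxx orbT.
  have := LD h x y hx hy; rewrite -/z xy bE !dualE hz mul1r mulr1 expr0n /= => b0'.
  by rewrite b0' eqxx in b0.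
have kernel2 u v : f u = 0 :> F -> f v = 0 :> F -> L u v = 0.
  move=> fu fv; apply: double_eq0.
  have := kernel (u + v); rewrite !amulE !kernel // add0r addr0 (Lc v u) dualE fu fv.
  by rewrite addr0; apply.
exists f, x, z; split=> // u v.
have fk w : f (w - f w *: x) = 0 :> F by rewrite !dualE fx mulr1 subrr.
have := kernel2 _ _ (fk u) (fk v); rewrite !amulE (Lc u x) !xE fx => h.
apply: (shift_eq h); apply: dual_ext => k; rewrite !dualE; ring.
Qed.

End Structure.

(** * Leibniz algebras with symmetric singular matrices *)

Section Leibniz.
Variables (F : numFieldType) (V : vectType F).
Implicit Types (L : alg V) (f : 'Hom(V, F^o)) (u v w x y z : V).

(** The right null vectors form a subspace on which [e] acts as the identity,
    and [e] spans a complement. *)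
Lemma iso_r_alg n L e : \dim {:V} = n -> e != 0 -> L e e = 0 ->
  (forall w, right_null L w -> L w e = w) ->
  (forall h, exists a, right_null L (h - a *: e)) ->
  isomorphic L (r_alg F n).
Proof.
move=> dimV e0 ee we split_e.
pose U := (\bigcap_(i < \dim {:V}) lker (L (vbasis {:V})`_i))%VS.
have UP u : reflect (right_null L u) (u \in U).
  apply: (iffP idP) => [|uN]; last first.
    by rewrite memvE; apply/subv_bigcapP => i _; rewrite -memvE memv_ker uN.
  rewrite memvE => /subv_bigcapP uU x.
  rewrite (basis_sum (vbasisP {:V}) x) linear_sum sum_lfunE big1 // => i _.
  rewrite amulZl; have := uU i isT; rewrite -memvE memv_ker => /eqP ->.
  by rewrite scaler0.
have eU : e \notin U.
  by apply: contra_neqN e0 => /UP /[dup] eN /we <-.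
have be : basis_of {:V} (e :: vbasis U).
  have -> : fullv = (<[e]> + U)%VS.
    apply/eqP; rewrite eqEsubv subvf andbT; apply/subvP => h _.
    have [a /UP aU] := split_e h.
    by rewrite -[h](subrK (a *: e)) addrC memv_add // memvZ // memv_line.
  rewrite -cat1s; apply: cat_basis; last exact: vbasisP.
    apply/directv_addP/eqP; rewrite -subv0; apply/subvP => v.
    rewrite memv_cap => /andP[/vlineP[a ->]] aeU; rewrite memv0 scaler_eq0.
    apply/orP; left; apply: contraNT eU => a0.
    by rewrite -[e]scale1r -(mulVf a0) -scalerA memvZ.
  exact: seq1_basis.
have sz : size (e :: vbasis U) == n by rewrite (size_full_basis be) dimV.
pose X : n.-tuple V := Tuple sz; have bX : basis_of fullv X by [].
have XU (i : 'I_n) : (0 < i)%N -> right_null L X`_i.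
  case: i => -[|i] //= lti _; apply/UP/vbasis_mem/mem_nth.
  by move: lti; rewrite -{1}(eqP sz).
apply: (iso_table bX) => i j k.
have [->|j0] := posnP j; last first.
  by rewrite XU // eqSS (gtn_eqF j0) andbF mxE dualE.
have [i0|i0] := posnP i; first by rewrite i0 /= ee mxE dualE.
rewrite /= we; last exact: XU.
by rewrite cdual_basis // ltnS i0 ltn_ord !mxE eqSS.
Qed.

Section Structure.
Variable L : alg V.
Hypothesis leibL : leibniz L.

Lemma right_null_square x : right_null L (L x x).
Proof. by move=> z; rewrite leibL subrr. Qed.

(** The linearization of [right_null_square]. *)
Lemma right_null_anticomm x y : right_null L (L x y + L y x).
Proof. by move=> z; rewrite !amulE !leibL addrA subrK subrr. Qed.

Lemma right_null_mul u z : right_null L u -> right_null L (L u z).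
Proof. by move=> uN w; rewrite leibL !uN amul0l subrr. Qed.

Lemma square_line x a : L x x = a *: x -> L x x = 0.
Proof.
move=> xx; have /eqP := right_null_square x x.
rewrite {1}xx amulZr xx scalerA scaler_eq0 mulf_eq0 orbb => /orP[] /eqP->.
  by rewrite scale0r.
by rewrite scaler0.
Qed.

Lemma leibniz_comm_nil : (forall x y, L x y = L y x) ->
  forall x y z, L x (L y z) = 0.
Proof.
move=> Lc x y z; apply: double_eq0.
by have := right_null_anticomm y z x; rewrite amulDr (Lc z y).
Qed.

(** Let [u] be a nonzero square, so that [V u = 0]. If also [u V = 0], the
    algebra is commutative by [symmetric_off_comm] and [squarelike_off_square]
    applies. Otherwise every right null [w] is an eigenvector of right
    multiplications, because [w z] lies in the span of [w] and [z] and is right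
    null; so some [e] acts on all of them as the identity, and it can be corrected
    to have [e e = 0]. Finally [e] and the right null vectors span [V]: for [h]
    outside, [h e + e h] is right null and lies in the span of [e] and [h], so it
    vanishes; but replacing [h] by [h + u] changes it by [u]. *)
Lemma leibniz_squarelike_off n : \dim {:V} = n -> symmetric_off L -> squarelike_off L ->
  (exists x, L x x != 0) ->
  ((forall x y, L x y = L y x) /\ square_alg L) \/ isomorphic L (r_alg F n).
Proof.
move=> dimV LJ LD nlie; have [x0 xx0] := nlie; pose u := L x0 x0.
have uN : right_null L u := right_null_square x0.
have [ul|] := pselect (forall z, L u z = 0).
  left; have Lc := symmetric_off_comm LJ xx0 ul uN; split=> //.
  exact: squarelike_off_square Lc (leibniz_comm_nil Lc) LD nlie.
move=> /existsNP[e0 ue0]; right.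
have eigen w z : right_null L w -> exists c, L w z = c *: w.
  move=> wN; have [a [b wz]] : exists a b, L w z = a *: w + b *: z.
    apply: span2_dual => f fw fz; rewrite (LJ f w z) //.
    by rewrite wN dualE.
  have [b0|b0] := eqVneq b 0; first by exists a; rewrite wz b0 scale0r addr0.
  exists 0; rewrite scale0r.
  have -> : z = b^-1 *: (L w z - a *: w).
    by rewrite wz addrC addKr scalerA mulVf // scale1r.
  by rewrite !amulE (right_null_mul z wN) wN scaler0 subr0 scaler0.
have [e1 ue1] : exists e1, L u e1 = u.
  have [c cE] := eigen u e0 uN.
  have c0 : c != 0 by apply/eqP => c0; apply: ue0; rewrite cE c0 scale0r.
  by exists (c^-1 *: e0); rewrite amulZr cE scalerA mulVf // scale1r.
pose q := L e1 e1; pose e := e1 - q.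
(* e e = e1 e1 - q e1 = 0, since V q = 0 and e1 fixes q from the right *)
have qN : right_null L q by apply: right_null_square.
have ue : L u e = u by rewrite amulDr amulNr qN subr0.
have we w : right_null L w -> L w e = w.
  move=> wN; have [a aE] := eigen w e wN.
  have [|b bE] := eigen (w + u) e; first by move=> x; rewrite amulDr wN uN addr0.
  rewrite amulDl ue aE in bE.
  have [ab|ab] := eqVneq a b.
    suff b1 : b = 1 by rewrite aE ab b1 scale1r.
    have /eqP : (b - 1) *: u = 0.
      apply: (shift_eq (esym bE)); rewrite ab; apply: dual_ext => f.
      by rewrite !dualE; ring.
    by rewrite scaler_eq0 (negPf xx0) orbF subr_eq0 => /eqP.
  have wu : w = ((b - 1) / (a - b)) *: u.
    have ab0 : a - b != 0 by rewrite subr_eq0.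
    apply: (scalerI ab0); apply: (shift_eq bE).
    by apply: dual_ext => f; rewrite !dualE; field.
  by rewrite wu amulZl ue.
have qe : L q e1 = q by rewrite -{2}(we q qN) amulDr amulNr qN subr0.
have ee : L e e = 0.
  by rewrite /e !amulE qe !qN !oppr0 !addr0 -/q subrr.
clearbody e; have eN : ~ right_null L e.
  by move=> eN; move: xx0; rewrite -/u -ue eN eqxx.
have e_neq0 : e != 0.
  by apply/eqP => e00; apply: eN => x; rewrite e00 amul0r.
apply: (iso_r_alg dimV e_neq0 ee we) => h; apply: contrapT => hN.
have anti h' : (forall a, ~ right_null L (h' - a *: e)) -> L h' e + L e h' = 0.
  move=> h'N; have vN := right_null_anticomm h' e; set v := _ + _ in vN *.
  have [a [b vE]] : exists a b, v = a *: e + b *: h'.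
    apply: span2_dual => f fe fh; have := LD f e h' fe fh.
    rewrite ee dualE mul0r => /esym/eqP; rewrite expf_eq0 /= => /eqP feh.
    by rewrite dualE (LJ f h' e) // feh addr0.
  have [b0|b0] := eqVneq b 0; last first.
    case: (h'N (- (a / b))) => x.
    have -> : h' - - (a / b) *: e = b^-1 *: v.
      by rewrite vE; apply: dual_ext => f; rewrite !dualE; field.
    by rewrite amulZr vN scaler0.
  rewrite b0 scale0r addr0 in vE; have [a0|a0] := eqVneq a 0.
    by rewrite vE a0 scale0r.
  case: eN => x; have -> : e = a^-1 *: v by rewrite vE scalerA mulVf // scale1r.
  by rewrite amulZr vN scaler0.
(* h + u is outside the span of e and the right null vectors as well *)
have h1 : L h e + L e h = 0 by apply: anti => a aN; apply: hN; exists a.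
have : L (h + u) e + L e (h + u) = 0.
  apply: anti => a aN; apply: hN; exists a => x.
  by have := aN x; rewrite !amulE (uN x) addr0.
rewrite amulDl amulDr uN addr0 addrAC h1 add0r ue => u0.
by move: xx0; rewrite -/u u0 eqxx.
Qed.

End Structure.
End Leibniz.

(** * Bilinear forms as algebras on V *)

Section Model.
Variables (F : numFieldType) (V : vectType F).
Hypothesis dim3 : (3 <= \dim {:V})%N.
Implicit Types (L M : alg V) (f : 'Hom(V, F^o)) (u v w x y z : V).

Let dim0 : (0 < \dim {:V})%N. Proof. exact: leq_trans dim3. Qed.
Let dim1 : (1 < \dim {:V})%N. Proof. exact: leq_trans dim3. Qed.

Let X := vbasis {:V}.
Let phi0 := cdual X (Ordinal dim0).
Let phi1 := cdual X (Ordinal dim1).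

(** [form_table] transported to [V] along a fixed basis, where it can be compared
    with the degenerations of [L] and depends polynomially on the matrix. *)
Definition form_alg (b11 b12 b21 b22 : F) : alg V :=
  b11 *: tensor phi0 phi0 X`_2 + b12 *: tensor phi0 phi1 X`_2 +
  b21 *: tensor phi1 phi0 X`_2 + b22 *: tensor phi1 phi1 X`_2.

Lemma form_algE b11 b12 b21 b22 x y : form_alg b11 b12 b21 b22 x y =
  (b11 * phi0 x * phi0 y + b12 * phi0 x * phi1 y +
   b21 * phi1 x * phi0 y + b22 * phi1 x * phi1 y) *: X`_2.
Proof.
rewrite /form_alg !(add_lfunE, scale_lfunE) !tensorE !scalerA -!scalerDl.
by congr (_ *: _); rewrite !mulrA.
Qed.

Lemma form_alg_basis : exists u0 u1 z f, [/\ z != 0, f z = 1 :> F, f u0 = 0 :> F,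
    f u1 = 0 :> F & forall b11 b12 b21 b22, let M := form_alg b11 b12 b21 b22 in
  [/\ M u0 u0 = b11 *: z, M u0 u1 = b12 *: z, M u1 u0 = b21 *: z & M u1 u1 = b22 *: z]].
Proof.
have bX : basis_of fullv X := vbasisP _.
pose i0 := Ordinal dim0; pose i1 := Ordinal dim1; pose i2 := Ordinal dim3.
exists X`_0, X`_1, X`_2, (cdual X i2).
split; try by rewrite (cdual_basis bX i2 i0, cdual_basis bX i2 i1, cdual_basis bX i2 i2).
  apply/eqP => z0; have := cdual_basis bX i2 i2; rewrite /= z0 dualE => /eqP.
  by rewrite eq_sym oner_eq0.
move=> b11 b12 b21 b22 M; rewrite /M !form_algE /phi0 /phi1 -/i0 -/i1.
rewrite !(cdual_basis bX i0 i0, cdual_basis bX i0 i1,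
          cdual_basis bX i1 i0, cdual_basis bX i1 i1) /=.
by split; congr (_ *: _); ring.
Qed.

Lemma form_alg_iso b11 b12 b21 b22 :
  isomorphic (form_alg b11 b12 b21 b22) (form_table (\dim {:V}) b11 b12 b21 b22).
Proof.
have bX : basis_of fullv X := vbasisP _.
apply: (iso_table bX) => i j k; rewrite form_algE dualE.
have -> : X`_2 = X`_(Ordinal dim3) by [].
rewrite /phi0 /phi1 !(cdual_basis bX).
case: k => -[|[|[|k]]] ltk; case: i => -[|[|[|i]]] lti;
    case: j => -[|[|[|j]]] ltj; rewrite /= ?mxE /= -?[_ == _]/false -?[_ == _]/true /=; ring.
Qed.

Lemma form_alg_curve b11 b12 b21 b22 :
  upoly b11 -> upoly b12 -> upoly b21 -> upoly b22 ->
  polycurve (fun t => form_alg (b11 t) (b12 t) (b21 t) (b22 t)).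
Proof.
move=> p11 p12 p21 p22; apply: polycurve_eval => f x y.
eapply upoly_ext; first by move=> t; rewrite form_algE !dualE; reflexivity.
by repeat first [assumption | apply upolyC | apply upolyM | apply upolyD].
Qed.

Lemma degenerates_form L f x y : free [:: x; y] -> f x = 0 :> F -> f y = 0 :> F ->
  (exists z, f z != 0 :> F) ->
  degenerates L (form_alg (f (L x x)) (f (L x y)) (f (L y x)) (f (L y y))).
Proof.
move=> fxy fx fy fz.
exact: degenerates_form_table fxy fx fy fz (form_alg_iso _ _ _ _).
Qed.

Lemma degenerates_limit L b11 b12 b21 b22 :
  upoly b11 -> upoly b12 -> upoly b21 -> upoly b22 ->
  (forall t, t != 0 -> degenerates L (form_alg (b11 t) (b12 t) (b21 t) (b22 t))) ->
  degenerates L (form_alg (b11 0) (b12 0) (b21 0) (b22 0)).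
Proof.
move=> p11 p12 p21 p22 H.
exact: (degenerates_curve (form_alg_curve p11 p12 p21 p22) H).
Qed.

End Model.

(** * Normal forms and general position *)

Section Points.
Variables (F : numFieldType) (V : vectType F).
Implicit Types (L M : alg V) (f : 'Hom(V, F^o)) (u v w x y z : V).

(** A linear relation between [x] and [y] is a relation between the rows and
    between the columns of their matrix; it is trivial if the matrix is invertible
    or not symmetric. *)
Lemma free_of_form L f x y :
  f (L x x) * f (L y y) != f (L x y) * f (L y x) :> F \/
    f (L x y) != f (L y x) :> F -> free [:: x; y].
Proof.
move=> H; apply: free2P => a b ab.
have zl u : a * f (L x u) + b * f (L y u) = 0 :> F.
  by have := congr1 (fun v => f (L v u)) ab; rewrite /= !amulE !dualE.
have zr u : a * f (L u x) + b * f (L u y) = 0 :> F.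
  by have := congr1 (fun v => f (L u v)) ab; rewrite /= !amulE !dualE.
case: H => H.
  have d0 : f (L x x) * f (L y y) - f (L x y) * f (L y x) != 0 :> F.
    by rewrite subr_eq0.
  split; apply: (mulIf d0); rewrite mul0r.
    apply: (shift_eq (c := (a * f (L x x) + b * f (L y x)) * f (L y y)
      - (a * f (L x y) + b * f (L y y)) * f (L y x)) (d := 0)).
      by rewrite !zl !mul0r subrr.
    by ring.
  apply: (shift_eq (c := (a * f (L x y) + b * f (L y y)) * f (L x x)
    - (a * f (L x x) + b * f (L y x)) * f (L x y)) (d := 0)).
    by rewrite !zl !mul0r subrr.
  by ring.
have d0 : f (L x y) - f (L y x) != 0 :> F by rewrite subr_eq0.
split; apply: (mulIf d0); rewrite mul0r.
  apply: (shift_eq (etrans (zl y) (esym (zr y)))); ring.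
apply: (shift_eq (etrans (zr x) (esym (zl x)))); ring.
Qed.

Lemma free_scale x y a b c : free [:: x; y] -> a != 0 -> c != 0 ->
  free [:: a *: x; b *: x + c *: y].
Proof.
rewrite free_cons span_seq1 seq1_free => /andP[xy y0] a0 c0; apply: free2P => p q.
have -> : p *: (a *: x) + q *: (b *: x + c *: y) = (p * a + q * b) *: x + (q * c) *: y.
  by apply: dual_ext => f; rewrite !dualE; ring.
move=> pq; have pq0 : p * a + q * b = 0.
  apply: contraNeq xy => k0; apply/vlineP; exists (- (q * c) / (p * a + q * b)).
  apply: (scalerI k0); apply: (shift_eq pq).
  by apply: dual_ext => f; rewrite !dualE; field.
move/eqP: pq; rewrite pq0 scale0r add0r scaler_eq0 (negPf y0) orbF.
rewrite mulf_eq0 (negPf c0) orbF => /eqP q0; split=> //.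
by move/eqP: pq0; rewrite q0 mul0r addr0 mulf_eq0 (negPf a0) orbF => /eqP.
Qed.

Lemma dual_normalize f v : exists g : 'Hom(V, F^o), forall u, g u = f u / f v :> F.
Proof. by exists ((f v)^-1 *: f) => u; rewrite dualE mulrC. Qed.

Section Dim3.
Hypothesis dim3 : (3 <= \dim {:V})%N.

(** Replacing [y] by [t *: y] and letting [t] go to 0 leaves only the first
    entry of the matrix. *)
Lemma degenerates_form_square L f x y : free [:: x; y] -> f x = 0 :> F ->
  f y = 0 :> F -> f (L x x) != 0 :> F -> degenerates L (form_alg dim3 1 0 0 0).
Proof.
move=> xy fx fy b0; have [g gE] := dual_normalize f (L x x).
have gx : g x = 0 :> F by rewrite gE fx mul0r.
have gy : g y = 0 :> F by rewrite gE fy mul0r.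
have gxx : g (L x x) = 1 :> F by rewrite gE divff.
have := @degenerates_limit F V dim3 L (fun=> 1) (fun t => t * g (L x y))
  (fun t => t * g (L y x)) (fun t => t ^+ 2 * g (L y y)).
rewrite expr0n /= !mul0r; apply=> [||||t t0].
- exact: upolyC.
- by apply: upolyM; [apply: upolyX | apply: upolyC].
- by apply: upolyM; [apply: upolyX | apply: upolyC].
- by apply: upolyM; [apply/upolyXn/upolyX | apply: upolyC].
have := @degenerates_form F V dim3 L g x (t *: y).
rewrite !amulE !dualE gy mulr0 gxx mulrA -expr2; apply=> //; last first.
  by exists (L x x); rewrite gxx oner_eq0.
have := free_scale 0 xy (oner_neq0 F) t0.
by rewrite scale1r scale0r add0r.
Qed.

(** The second vector [y' = b x + c y] is chosen with [f (x y') = 0] and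
    [f (y' x) = f (x x)]. *)
Lemma degenerates_L4 L f x y : f x = 0 :> F -> f y = 0 :> F ->
  f (L x x) != 0 :> F -> f (L x y) != f (L y x) :> F ->
  degenerates L (form_alg dim3 1 0 1
    ((f (L x x) * f (L y y) - f (L x y) * f (L y x)) / (f (L x y) - f (L y x)) ^+ 2)).
Proof.
move=> fx fy b0; rewrite -subr_eq0 => j0.
have xy : free [:: x; y] by apply: (@free_of_form L f); right; rewrite -subr_eq0.
have [g gE] := dual_normalize f (L x x).
pose b := f (L x y) / (f (L x y) - f (L y x)) : F.
pose c := - f (L x x) / (f (L x y) - f (L y x)) : F.
have c0 : c != 0 by rewrite mulf_neq0 ?oppr_eq0 ?invr_eq0.
have := @degenerates_form F V dim3 L g x (b *: x + c *: y).
have -> : g (L x x) = 1 :> F by rewrite gE divff.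
have -> : g (L x (b *: x + c *: y)) = 0 :> F.
  by rewrite gE !amulE !dualE /b /c; field; rewrite b0 j0.
have -> : g (L (b *: x + c *: y) x) = 1 :> F.
  by rewrite gE !amulE !dualE /b /c; field; rewrite b0 j0.
have -> : g (L (b *: x + c *: y) (b *: x + c *: y)) =
    (f (L x x) * f (L y y) - f (L x y) * f (L y x)) / (f (L x y) - f (L y x)) ^+ 2 :> F.
  by rewrite gE !amulE !dualE /b /c; field; rewrite b0 j0.
apply.
- by have := free_scale b xy (oner_neq0 F) c0; rewrite scale1r.
- by rewrite gE fx mul0r.
- by rewrite gE !dualE fx fy !mulr0 addr0 mul0r.
- by exists (L x x); rewrite gE divff // oner_eq0.
Qed.
End Dim3.

(** Dependent [x] and [y] are allowed, so that the triples [(f, x, y)] can be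
    joined by polynomial curves. *)
Definition nonvanishing (q : F -> F -> F -> F -> F) L := exists f x y,
  [/\ f x = 0 :> F, f y = 0 :> F &
      q (f (L x x)) (f (L x y)) (f (L y x)) (f (L y y)) != 0].

(** What joining triples by a curve asks of [q]: the curve reaches its end points
    only up to a scalar factor on the matrix, and needs a nonzero [f] at both
    ends, which [q 0 0 0 0 = 0] provides. *)
Definition conic_poly (q : F -> F -> F -> F -> F) :=
  [/\ q 0 0 0 0 = 0,
      forall s a b c d, s != 0 -> q a b c d != 0 -> q (s * a) (s * b) (s * c) (s * d) != 0 &
      forall a b c d, upoly a -> upoly b -> upoly c -> upoly d ->
        upoly (fun t => q (a t) (b t) (c t) (d t))].

(** The triples [(f, x, y)] with [f x = f y = 0] form an irreducible variety up
    to scaling: any two of them are joined by a polynomial curve, on which two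
    polynomials that are not identically zero have a common nonzero value. *)
Lemma nonvanishing_mul q r L : conic_poly q -> conic_poly r ->
  nonvanishing q L -> nonvanishing r L ->
  nonvanishing (fun a b c d => q a b c d * r a b c d) L.
Proof.
move=> [q0 qs qp] [r0 rs rp] [f [x [y [fx fy qn]]]] [g [x' [y' [gx gy rn]]]].
have [w1 fw1] : exists w, f w != 0 :> F.
  apply: contrapT => /forallNP f0.
  have fz z : f z = 0 :> F by apply/eqP/negPn/negP/f0.
  by move: qn; rewrite !fz q0 eqxx.
have [w2 gw2] : exists w, g w != 0 :> F.
  apply: contrapT => /forallNP f0.
  have fz z : g z = 0 :> F by apply/eqP/negPn/negP/f0.
  by move: rn; rewrite !fz r0 eqxx.
have [w [fw gw]] : exists w, f w != 0 :> F /\ g w != 0 :> F.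
  have [gw1|gw1] := eqVneq (g w1 : F) 0; last by exists w1.
  have [fw2|fw2] := eqVneq (f w2 : F) 0; last by exists w2.
  by exists (w1 + w2); rewrite !dualE gw1 fw2 addr0 add0r.
pose h t : 'Hom(V, F^o) := (1 - t) *: f + t *: g.
pose k (u v : V) t := (1 - t) *: u + t *: v.
(* a segment corrected along w so as to stay in the moving hyperplane h t *)
pose Z (u v : V) t := h t w *: k u v t - h t (k u v t) *: w.
have hZ u v t : h t (Z u v t) = 0 :> F by rewrite /Z !dualE; ring.
pose B t (u v u' v' : V) : F := h t (L (Z u v t) (Z u' v' t)).
have ph c d : upoly c -> upoly d -> forall u v,
    upoly (fun t => (1 - t) * (c t * f u + d t * f v) + t * (c t * g u + d t * g v)).
  move=> pc pd u v.
  by repeat first [assumption | apply upolyC | apply upolyX | apply upolyM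
                  | apply upolyD | apply upolyN].
have pk u v : upoly (fun t => h t (k u v t)).
  apply: upoly_ext (ph _ _ (upolyD (upolyC 1) (upolyN (upolyX F))) (upolyX F) u v) => t.
  by rewrite /h /k !dualE /=; ring.
have pL u v : upoly (fun t => h t (L u v)).
  apply: upoly_ext (ph _ _ (upolyC 1) (upolyC 0) (L u v) (L u v)) => t.
  by rewrite /h !dualE; ring.
have pw : upoly (fun t => h t w).
  apply: upoly_ext (ph _ _ (upolyC 1) (upolyC 0) w w) => t.
  by rewrite /h !dualE; ring.
have pB u v u' v' : upoly (fun t => B t u v u' v').
  apply: (upoly_ext (k := fun t =>
    h t w * h t w * ((1 - t) * ((1 - t) * h t (L u u') + t * h t (L u v')) +
                     t * ((1 - t) * h t (L v u') + t * h t (L v v'))) -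
    h t w * h t (k u' v' t) * ((1 - t) * h t (L u w) + t * h t (L v w)) -
    h t (k u v t) * h t w * ((1 - t) * h t (L w u') + t * h t (L w v')) +
    h t (k u v t) * h t (k u' v' t) * h t (L w w))).
    move=> t; rewrite /B /Z; set a := h t w; set c := h t (k u v t).
    set d := h t (k u' v' t); rewrite /k; move: (h t) a c d => ht a c d.
    by rewrite !amulE !(dualD, dualN, dualZ); ring.
  by repeat first [apply: pk | apply: pL | apply: pw | apply upolyC | apply upolyX
                  | apply upolyM | apply upolyD | apply upolyN].
have h0 : h 0 = f by rewrite /h subr0 scale1r scale0r addr0.
have h1 : h 1 = g by rewrite /h subrr scale0r scale1r add0r.
have Z0 u v : f u = 0 :> F -> Z u v 0 = f w *: u.
  by move=> fu; rewrite /Z h0 /k subr0 scale1r scale0r addr0 fu scale0r subr0.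
have Z1 u v : g v = 0 :> F -> Z u v 1 = g w *: v.
  by move=> gv; rewrite /Z h1 /k subrr scale0r scale1r add0r gv scale0r subr0.
have [||t qrt] := upoly_inf_mul
  (qp _ _ _ _ (pB x x' x x') (pB x x' y y') (pB y y' x x') (pB y y' y y'))
  (rp _ _ _ _ (pB x x' x x') (pB x x' y y') (pB y y' x x') (pB y y' y y')).
- exists 0; rewrite /B h0 !Z0 // !amulE !dualE !mulrA -expr2.
  by apply: qs => //; rewrite expf_neq0.
- exists 1; rewrite /B h1 !Z1 // !amulE !dualE !mulrA -expr2.
  by apply: rs => //; rewrite expf_neq0.
by exists (h t), (Z x x' t), (Z y y' t).
Qed.

End Points.

Section Closed.
Variables (F : numClosedFieldType) (V : vectType F).
Hypothesis dim3 : (3 <= \dim {:V})%N.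
Implicit Types (L M : alg V) (f : 'Hom(V, F^o)) (u v w x y z : V).

(** With [f (x x)] scaled to 1, the second vector [p x + q y] is chosen isotropic
    with product 1 with [x]; this asks for a square root of minus the determinant. *)
Lemma degenerates_L5 L f x y : f x = 0 :> F -> f y = 0 :> F ->
  f (L x x) != 0 :> F -> f (L x y) = f (L y x) :> F ->
  f (L x x) * f (L y y) != f (L x y) * f (L y x) :> F ->
  degenerates L (form_alg dim3 1 1 1 0).
Proof.
move=> fx fy xx0 j0 d0.
have xy : free [:: x; y] by apply: (@free_of_form F V L f); left.
have [g gE] := dual_normalize f (L x x).
pose b : F := g (L x y); pose d : F := g (L y y).
have gxx : g (L x x) = 1 :> F by rewrite gE divff.
have gyx : g (L y x) = b by rewrite /b !gE j0.
have bd : b ^+ 2 - d != 0.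
  apply: contraNneq d0; rewrite /b /d !gE -j0 => /eqP; rewrite subr_eq0 => /eqP h.
  apply/eqP; apply: (mulfI (x := (f (L x x))^-2)); first by rewrite invr_eq0 expf_neq0.
  by apply: (shift_eq (esym h)); field.
pose q := (sqrtC (b ^+ 2 - d))^-1.
have q2 : q ^+ 2 * (b ^+ 2 - d) = 1 by rewrite exprVn sqrtCK mulVf.
have q0 : q != 0 by rewrite invr_eq0 sqrtC_eq0.
pose p := 1 - q * b.
have := @degenerates_form F V dim3 L g x (p *: x + q *: y).
have -> : g (L x (p *: x + q *: y)) = 1 :> F.
  by rewrite !amulE dualD !dualZ gxx -/b /p; ring.
have -> : g (L (p *: x + q *: y) x) = 1 :> F.
  by rewrite !amulE dualD !dualZ gxx gyx /p; ring.
have -> : g (L (p *: x + q *: y) (p *: x + q *: y)) = 0 :> F.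
  rewrite !amulE !(dualD, dualZ) gxx gyx -/b -/d /p.
  by apply: (shift_eq (esym q2)); ring.
rewrite gxx; apply.
- by have := free_scale p xy (oner_neq0 F) q0; rewrite scale1r.
- by rewrite gE fx mul0r.
- by rewrite !dualE !gE fx fy !mul0r !mulr0 addr0.
- by exists (L x x); rewrite gxx oner_eq0.
Qed.
End Closed.

(** * Conditions that survive degeneration *)

Section Transfer.
Variables (F : numFieldType) (V : vectType F).
Implicit Types (L M : alg V) (f : 'Hom(V, F^o)) (u v w x y z : V).

Lemma isoE L M : isomorphic L M -> exists g h : 'End(V),
  [/\ cancel g h, cancel h g & forall x y, M x y = g (L (h x) (h y))].
Proof.
move=> [g [k gK kK] gM].
have [h hE] : exists h : 'End(V), h =1 k.
  apply: lfun_exists => a u v; apply: (can_inj gK).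
  by rewrite /= kK linearP /= !kK.
exists g, h; split=> [x|x|x y]; rewrite ?hE //.
by rewrite gM !kK.
Qed.

Lemma polyfun_mul f x y : polyfun (fun M => f (M x y)).
Proof.
have [l lE] : exists l : 'Hom(alg V, F^o), l =1 (fun M => f (M x y)).
  by apply: lfun_exists => a L M; rewrite !add_lfunE !scale_lfunE linearP.
by apply: polyfun_ext (polyfun_dual l) => M; rewrite lE.
Qed.

Lemma polyfun_mul_mulr f x y z : polyfun (fun M => f (M x (M y z))).
Proof.
pose X := vbasis {:V}; have bX : basis_of fullv X := vbasisP _.
apply: (polyfun_ext (r := fun M =>
  \sum_(i < \dim {:V}) cdual X i (M y z) * f (M x X`_i))).
  move=> M; rewrite {1}(basis_sum bX (M y z)) linear_sum dual_sum.
  by apply: eq_bigr => i _; rewrite /= amulZr dualE.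
by apply: polyfun_sum => i; apply: polyfunM; apply: polyfun_mul.
Qed.

Lemma polyfun_mul_mull f x y z : polyfun (fun M => f (M (M x y) z)).
Proof.
pose X := vbasis {:V}; have bX : basis_of fullv X := vbasisP _.
apply: (polyfun_ext (r := fun M =>
  \sum_(i < \dim {:V}) cdual X i (M x y) * f (M X`_i z))).
  move=> M; rewrite {1}(basis_sum bX (M x y)) linear_sum sum_lfunE dual_sum.
  by apply: eq_bigr => i _; rewrite amulZl dualE.
by apply: polyfun_sum => i; apply: polyfunM; apply: polyfun_mul.
Qed.

Lemma leibniz_closed L M : degenerates L M -> leibniz L -> leibniz M.
Proof.
move=> LM leibL x y z; apply: dual_ext => f.
apply/eqP; rewrite -subr_eq0; apply/eqP.
apply: (degenerates_closed (q := fun M => f (M x (M y z)) -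
  f (M (M x y) z - M (M x z) y)) _ LM).
  apply: (polyfun_ext (r := fun M => f (M x (M y z)) +
    - (f (M (M x y) z) + - f (M (M x z) y)))); first by move=> N; rewrite !dualE.
  apply: polyfunD; first exact: polyfun_mul_mulr.
  apply: polyfunN; apply: polyfunD; first exact: polyfun_mul_mull.
  by apply: polyfunN; apply: polyfun_mul_mull.
move=> N /isoE[g [h [gh hg NE]]].
by rewrite !NE !gh leibL (linearB g) subrr.
Qed.

Lemma comm_closed L M : degenerates L M -> (forall x y, L x y = L y x) ->
  forall x y, M x y = M y x.
Proof.
move=> LM Lc x y; apply: dual_ext => f; apply/eqP; rewrite -subr_eq0; apply/eqP.
apply: (degenerates_closed (q := fun M => f (M x y) - f (M y x)) _ LM).
  by apply: polyfunD; [|apply: polyfunN]; apply: polyfun_mul.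
by move=> N /isoE[g [h [_ _ NE]]]; rewrite !NE Lc subrr.
Qed.

Definition squarelike L := forall f x y, f (L x x) * f (L y y) = f (L x y) ^+ 2 :> F.

Lemma squarelike_closed L M : degenerates L M -> squarelike L -> squarelike M.
Proof.
move=> LM Lr f x y; apply/eqP; rewrite -subr_eq0; apply/eqP.
apply: (degenerates_closed (q := fun M => f (M x x) * f (M y y) - f (M x y) ^+ 2) _ LM).
  apply: polyfunD; first by apply: polyfunM; apply: polyfun_mul.
  by apply: polyfunN; apply: polyfunM; apply: polyfun_mul.
move=> N /isoE[g [h [_ _ NE]]].
have := Lr (f \o g)%VF (h x) (h y).
by rewrite !NE !comp_lfunE /= => ->; rewrite subrr.
Qed.

(** The contrapositive of: if [q] vanishes on all matrices of [L], so does it on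
    those of its degenerations. *)
Lemma nonvanishing_closed q L M : degenerates L M ->
  (forall f x y, polyfun (fun M => q (f (M x x)) (f (M x y)) (f (M y x)) (f (M y y)))) ->
  nonvanishing q M -> nonvanishing q L.
Proof.
move=> LM qP [f [x [y [fx fy]]]]; apply: contraPP => Lq; apply/negP/negPn/eqP.
apply: (degenerates_closed (qP f x y) LM) => N /isoE[g [h [gh hg NE]]].
apply/eqP/negPn/negP => qn; rewrite !NE in qn; apply: Lq; exists (f \o g)%VF, (h x), (h y).
by split; rewrite !comp_lfunE /= ?hg.
Qed.

(** The matrix of the linear map that sends [y] to its right multiplication. *)
Definition null_matrix M : 'M[F]_(\dim {:V}, \dim {:V} * \dim {:V}) :=
  \matrix_(j < \dim {:V}) mxvec (\matrix_(i < \dim {:V}, k < \dim {:V})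
    (cdual (vbasis {:V}) k (M (vbasis {:V})`_i (vbasis {:V})`_j) : F)).

Lemma null_matrixE M j i k : null_matrix M j (mxvec_index i k) =
  cdual (vbasis {:V}) k (M (vbasis {:V})`_i (vbasis {:V})`_j).
Proof. by rewrite mxE mxvecE mxE. Qed.

Lemma null_matrix_mul M (r : 'rV[F]_(\dim {:V})) i k :
  (r *m null_matrix M) 0 (mxvec_index i k) =
  cdual (vbasis {:V}) k (M (vbasis {:V})`_i (\sum_(j < \dim {:V}) r 0 j *: (vbasis {:V})`_j)).
Proof.
rewrite mxE linear_sum dual_sum; apply: eq_bigr => j _.
by rewrite null_matrixE linearZ /= dualE.
Qed.

(** If right multiplication is injective for [M], its matrix has a left inverse
    [B], and the determinant of its product with [B] is a polynomial function
    that vanishes on the orbit of [L] but not at [M]. *)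
Lemma right_null_closed L M : degenerates L M ->
  (exists2 u, u != 0 & right_null L u) -> exists2 u, u != 0 & right_null M u.
Proof.
pose X := vbasis {:V}; have bX : basis_of fullv X := vbasisP _.
move=> LM [u u0 uN]; apply: contrapT => Mn.
have /row_freeP[B AB] : row_free (null_matrix M).
  apply: inj_row_free => r rA.
  suff u'0 : \sum_(j < \dim {:V}) r 0 j *: X`_j = 0.
    apply/rowP => j; rewrite mxE.
    by rewrite -(coord_sum_free (fun j => r 0 j) j (basis_free bX)) u'0 linear0.
  apply: contrapT => /eqP u'0; apply: Mn; exists (\sum_(j < \dim {:V}) r 0 j *: X`_j) => // x.
  rewrite (basis_sum bX x) (linear_sum M) sum_lfunE big1 // => i _.
  rewrite amulZl [X in _ *: X](_ : _ = 0) ?scaler0 //.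
  rewrite [LHS](basis_sum bX) big1 // => k _.
  by rewrite -null_matrix_mul rA mxE scale0r.
suff /eqP : \det (null_matrix M *m B) = 0 by rewrite AB det1 oner_eq0.
apply: (degenerates_closed (q := fun M => \det (null_matrix M *m B)) _ LM).
  apply: polyfun_det => j l.
  apply: (polyfun_ext (r := fun M => \sum_c null_matrix M j c * B c l)).
    by move=> N; rewrite mxE.
  apply: polyfun_sum => c; apply: polyfunM; last exact: polyfunC.
  case/mxvec_indexP: c => i k.
  apply: (polyfun_ext (r := fun N : alg V => (cdual X k (N X`_i X`_j)) : F)).
    by move=> N; rewrite null_matrixE.
  exact: polyfun_mul.
move=> N /isoE[g [h [gh hg NE]]].
apply/eqP/det0P; exists (\row_j cdual X j (g u)).
  apply: contra_neq u0 => /rowP r0; apply: (can_inj gh); rewrite linear0.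
  rewrite [LHS](basis_sum bX) big1 // => j _; have := r0 j; rewrite !mxE => ->.
  by rewrite scale0r.
rewrite mulmxA; suff -> : (\row_j cdual X j (g u)) *m null_matrix N = 0 by rewrite mul0mx.
apply/rowP => c; case/mxvec_indexP: c => i k; rewrite null_matrix_mul mxE.
have -> : \sum_(j < \dim {:V}) (\row_j cdual X j (g u)) 0 j *: X`_j = g u.
  by rewrite [RHS](basis_sum bX); apply: eq_bigr => j _; rewrite mxE.
by rewrite NE gh uN linear0 dualE.
Qed.

End Transfer.

(** * First degenerations of a Leibniz algebra *)

Section SquareAlgebra.
Variables (F : numFieldType) (V : vectType F).
Implicit Types (L M : alg V) (f : 'Hom(V, F^o)) (u v w x y z : V).

Lemma square_alg_table L : square_alg L ->
  isomorphic L (alg_of_table (fun i j =>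
    if (i == 1)%N && (j == 1)%N then bas F (\dim {:V}) 2 else 0)).
Proof.
move=> [f [x [z [fx fz z0 LE]]]].
have [||r br rf] := @hyperplane_basis F V f x [:: z] fx; first by rewrite seq1_free.
  by move=> u; rewrite inE => /eqP->.
rewrite cat1s in br.
have sz : size (x :: z :: r) == \dim {:V} by rewrite (size_full_basis br).
pose X : (\dim {:V}).-tuple V := Tuple sz; have bX : basis_of fullv X by [].
have Xf (i : 'I_(\dim {:V})) : f X`_i = (i == 0 :> nat)%:R :> F.
  case: i => -[|[|i]] lti /=; rewrite ?fx ?fz //.
  apply: rf; rewrite mem_nth //.
  by move: lti; rewrite -{1}(eqP sz) /= !ltnS.
apply: (iso_table bX) => i j k; rewrite LE !Xf dualE !eqSS.
have lt1 : (1 < \dim {:V})%N by rewrite -(eqP sz).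
have -> : z = X`_(Ordinal lt1) by [].
rewrite (cdual_basis bX).
case: ifP => [/andP[/eqP-> /eqP->]|ij]; first by rewrite !mxE !mul1r eqSS.
by rewrite mxE -natrM mulnb ij mul0r.
Qed.

Lemma square_alg_iso L M : square_alg L -> square_alg M -> isomorphic L M.
Proof.
move=> /square_alg_table LT /square_alg_table MT.
exact: iso_trans LT (iso_sym MT).
Qed.

Lemma square_alg_squarelike L : square_alg L -> squarelike L.
Proof.
by move=> [g [_ [z [_ _ _ LE]]]] f x y; rewrite !LE !dualE; ring.
Qed.

Lemma nonzero_square L : L != 0 -> (forall x y, L x y = L y x) -> exists x, L x x != 0.
Proof.
move=> L0 Lc; apply: contrapT => H; case/eqP: L0; apply: alg_ext => x y.
have sq u : L u u = 0 by apply/eqP/negPn/negP => uu; apply: H; exists u.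
rewrite zero_lfunE zero_lfunE; apply: double_eq0.
by have := sq (x + y); rewrite !amulE !sq add0r addr0 (Lc y x).
Qed.

(** Commutativity and the relations [f (x x) f (y y) = f (x y) ^ 2] are closed,
    and among nonzero Leibniz algebras they characterize this product. *)
Lemma square_alg_closed L M : leibniz L -> square_alg L ->
  (forall x y, L x y = L y x) -> degenerates L M -> M != 0 -> isomorphic L M.
Proof.
move=> leibL Lsq Lc LM M0; apply: square_alg_iso => //.
have Mc := comm_closed LM Lc; have leibM := leibniz_closed LM leibL.
apply: squarelike_off_square => //; first exact: leibniz_comm_nil leibM Mc.
  by move=> f x y _ _; apply: (squarelike_closed LM); apply: square_alg_squarelike.
exact: nonzero_square.
Qed.

End SquareAlgebra.

Section OffLine.
Variables (F : numFieldType) (V : vectType F).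
Implicit Types (L M : alg V) (f : 'Hom(V, F^o)) (u v w x y z : V).

Lemma not_symmetric_squarelike L : ~ (symmetric_off L /\ squarelike_off L) ->
  (exists f x y, [/\ f x = 0 :> F, f y = 0 :> F & f (L x y) != f (L y x) :> F]) \/
  (exists f x y, [/\ f x = 0 :> F, f y = 0 :> F, f (L x y) = f (L y x) :> F &
     f (L x x) * f (L y y) != f (L x y) * f (L y x) :> F]).
Proof.
move=> nJD; have [LJ|] := pselect (symmetric_off L); last first.
  move=> /existsNP[f /existsNP[x /existsNP[y]]].
  move=> /not_implyP[fx] /not_implyP[fy] /eqP fxy.
  by left; exists f, x, y.
right; have : ~ squarelike_off L by move=> LD; apply: nJD.
move=> /existsNP[f /existsNP[x /existsNP[y]]].
move=> /not_implyP[fx] /not_implyP[fy] /eqP D0.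
by exists f, x, y; split; rewrite ?(LJ f y x) // -?expr2 // LJ.
Qed.

Lemma free_hyperplane_dim f x y v : free [:: x; y] -> f x = 0 :> F ->
  f y = 0 :> F -> f v != 0 :> F -> (3 <= \dim {:V})%N.
Proof.
move=> xy fx fy fv.
have fv1 : f ((f v)^-1 *: v) = 1 :> F by rewrite dualE mulVf.
have [|r br _] := hyperplane_basis fv1 xy.
  by move=> u; rewrite !inE => /orP[]/eqP->.
by rewrite -(size_full_basis br).
Qed.

Lemma dim3_not_symmetric_squarelike L :
  ~ (symmetric_off L /\ squarelike_off L) -> (3 <= \dim {:V})%N.
Proof.
move=> /not_symmetric_squarelike[] [f [x [y [fx fy]]]] => [xy|_ D0].
  have fxy : free [:: x; y] by apply: (@free_of_form F V L f); right.
  have [y0|] := eqVneq (f (L x y) : F) 0; last exact: free_hyperplane_dim fxy fx fy.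
  by apply: (@free_hyperplane_dim f x y (L y x)) => //; rewrite eq_sym -y0.
have fxy : free [:: x; y] by apply: (@free_of_form F V L f); left.
have [x0|] := eqVneq (f (L x x) : F) 0; last exact: free_hyperplane_dim fxy fx fy.
apply: (@free_hyperplane_dim f x y (L x y)) => //.
by apply: contraNneq D0 => ->; rewrite x0 !mul0r.
Qed.

(** If [x x] were a multiple of [x], the identity [x (x x) = 0] would make it
    vanish. *)
Lemma square_off_line L : leibniz L -> (exists x, L x x != 0) ->
  exists f x, f x = 0 :> F /\ f (L x x) = 1 :> F.
Proof.
move=> leibL [x xx0].
have [|f fk fz] := @separate_seq F V [:: x] (L x x).
  apply/negP; rewrite span_seq1 => /vlineP[a xxE].
  by move: xx0; rewrite (square_line leibL xxE) eqxx.
by exists f, x; split=> //; apply: fk; rewrite inE.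
Qed.

Lemma nonvanishing_square L : leibniz L -> (exists x, L x x != 0) ->
  nonvanishing (fun a b c d => a) L.
Proof.
move=> leibL /(square_off_line leibL)[f [x [fx fxx]]].
by exists f, x, x; split; rewrite ?fxx ?oner_eq0.
Qed.

Lemma conic_b11 : @conic_poly F (fun a b c d => a).
Proof. by split=> // s a b c d s0 a0; rewrite mulf_neq0. Qed.

Lemma conic_asym : @conic_poly F (fun a b c d => b - c).
Proof.
split=> [|s a b c d s0 bc|a b c d pa pb pc pd]; first exact: subr0.
  by rewrite -mulrBr mulf_neq0.
by apply: upolyD => //; apply: upolyN.
Qed.

Hypothesis dim3 : (3 <= \dim {:V})%N.
Local Notation form := (form_alg dim3).

Lemma leibniz_degenerates_square L : leibniz L -> (exists x, L x x != 0) ->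
  degenerates L (form 1 0 0 0).
Proof.
move=> leibL /(square_off_line leibL)[f [x [fx fz]]].
have x0 : x != 0.
  by apply: contra_eq_neq fz => ->; rewrite amul0l dualE eq_sym oner_eq0.
have fx1 : free [:: x] by rewrite seq1_free.
have [|r br rf] := hyperplane_basis fz fx1.
  by move=> u; rewrite inE => /eqP->.
have : (3 <= size (L x x :: [:: x] ++ r))%N.
  by rewrite (size_full_basis br).
case: r br rf => // y r br rf _.
have xy : free [:: x; y].
  have : free [:: L x x, x, y & r] := basis_free br.
  by rewrite -[[:: _, _, _ & _]]/([:: L x x] ++ ([:: x; y] ++ r)) => /catr_free/catl_free.
have fy : f y = 0 :> F by apply: rf; rewrite inE eqxx.
have fxx : f (L x x) != 0 :> F by rewrite fz oner_eq0.
exact: degenerates_form_square xy fx fy fxx.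
Qed.

End OffLine.

Lemma leibniz_degenerates_L4_L5 (F : numClosedFieldType) (V : vectType F)
    (dim3 : (3 <= \dim {:V})%N) (L : alg V) :
  leibniz L -> (exists x, L x x != 0) -> ~ (symmetric_off L /\ squarelike_off L) ->
  (exists a, degenerates L (form_alg dim3 1 0 1 a)) \/
  degenerates L (form_alg dim3 1 1 1 0).
Proof.
move=> leibL Lxx /not_symmetric_squarelike[] [f [x [y [fx fy]]]] => [xyJ|xyC D0].
  have Jp : nonvanishing (fun a b c d => b - c) L.
    by exists f, x, y; split=> //; rewrite subr_eq0.
  have [f' [x' [y' [fx' fy']]]] :=
    nonvanishing_mul (@conic_b11 F) (@conic_asym F) (nonvanishing_square leibL Lxx) Jp.
  rewrite mulf_eq0 negb_or subr_eq0 => /andP[xx0 xy].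
  by left; eexists; apply: degenerates_L4 fx' fy' xx0 xy.
right; have [xx0|xx0] := eqVneq (f (L x x) : F) 0; last first.
  exact: degenerates_L5 fx fy xx0 xyC D0.
have [yy0|yy0] := eqVneq (f (L y y) : F) 0; last first.
  apply: (degenerates_L5 fy fx yy0 (esym xyC)).
  by rewrite mulrC [X in _ != X]mulrC.
have xy0 : f (L x y) != 0 :> F.
  by apply: contraNneq D0 => xy0; rewrite xx0 xy0 !mul0r.
have fxy : f (x + y) = 0 :> F by rewrite dualE fx fy addr0.
apply: (degenerates_L5 fxy fy).
- rewrite !amulE !dualE xx0 yy0 -xyC add0r addr0 -mulr2n -mulr_natl.
  by rewrite mulf_neq0 ?pnatr_eq0.
- by rewrite !amulE !dualE xyC.
- by rewrite !amulE !dualE xx0 yy0 -xyC mulr0 !addr0 eq_sym mulf_neq0.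
Qed.

(** * Chains of length two *)

Section LevelTwo.
Variables (F : numClosedFieldType) (V : vectType F).
Implicit Types (L M : alg V) (f : 'Hom(V, F^o)) (u v w x y z : V).

Section Dim3.
Hypothesis dim3 : (3 <= \dim {:V})%N.
Local Notation form := (form_alg dim3).

Lemma squarelike_form_square : squarelike (form 1 0 0 0).
Proof. by move=> f x y; rewrite !form_algE !dualE; ring. Qed.

(** The two equations single out the multiples of squares, and fail for the
    matrices of [L4_a] and [L5_a]. *)
Lemma squarelike_form a b c d : squarelike (form a b c d) -> a * d = b ^+ 2 /\ a * d = c ^+ 2.
Proof.
have [u0 [u1 [z [f [z0 fz f0 f1 /(_ a b c d) /=[m00 m01 m10 m11]]]]]] :=
  form_alg_basis dim3.
move=> Mr; have := Mr f u0 u1; have := Mr f u1 u0.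
by rewrite m00 m01 m10 m11 !dualE fz !mulr1 [d * a]mulrC.
Qed.

Lemma form_square_neq0 a b c d : a != 0 -> exists x, form a b c d x x != 0.
Proof.
have [u0 [u1 [z [f [z0 fz f0 f1 /(_ a b c d) /=[m00 _ _ _]]]]]] :=
  form_alg_basis dim3.
by move=> a0; exists u0; rewrite m00 scaler_eq0 negb_or a0.
Qed.

(** The symmetric part of the matrix of [L_4 (1/4)] has rank one. In a basis
    adapted to its kernel, scaling by [t] and [1 / t] shrinks the symmetric part
    and keeps the alternating part. *)
Lemma L4_quarter_degenerates : degenerates (form 1 0 1 4^-1) (form 0 1 (- 1) 0).
Proof.
have [u0 [u1 [z [f [z0 fz f0 f1 /(_ 1 0 1 4^-1)]]]]] := form_alg_basis dim3.
set M := form 1 0 1 4^-1 => /=[[m00 m01 m10 m11]].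
have := @degenerates_limit F V dim3 M (fun t => t ^+ 2) (fun=> 1) (fun=> -1) (fun=> 0).
rewrite expr0n; apply=> [||||t t0]; try exact: upolyC.
  exact/upolyXn/upolyX.
have u01 : free [:: u0; u1].
  apply: (@free_of_form F V M f); right.
  by rewrite m01 m10 !dualE fz mul0r mul1r eq_sym oner_eq0.
have t2 : - 2 / t != 0 by rewrite mulf_neq0 ?invr_eq0 ?oppr_eq0 ?pnatr_eq0.
have := @degenerates_form F V dim3 M f (t *: u0) (t^-1 *: u0 + (- 2 / t) *: u1).
have -> : f (M (t *: u0) (t *: u0)) = t ^+ 2 :> F.
  by rewrite !amulE m00 !dualE fz; ring.
have -> : f (M (t *: u0) (t^-1 *: u0 + (- 2 / t) *: u1)) = 1 :> F.
  by rewrite !amulE m00 m01 !dualE fz; field.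
have -> : f (M (t^-1 *: u0 + (- 2 / t) *: u1) (t *: u0)) = -1 :> F.
  by rewrite !amulE m00 m10 !dualE fz; field.
have -> : f (M (t^-1 *: u0 + (- 2 / t) *: u1) (t^-1 *: u0 + (- 2 / t) *: u1)) = 0 :> F.
  by rewrite !amulE m00 m01 m10 m11 !dualE fz; field.
apply; last by exists z; rewrite fz oner_eq0.
- exact: free_scale.
- by rewrite dualE f0 mulr0.
- by rewrite !dualE f0 f1 !mulr0 addr0.
Qed.

(** Otherwise some polynomial [r] in [a] vanishes whenever [L] degenerates to
    [L_4 a], but not at 1/4. Let [s] be its roots: at each plane of [L] with
    [b_11 <> 0] and [b_12 <> b_21], the determinant is one of the
    [i * (b_12 - b_21) ^ 2] for [i] in [s], so that [P] vanishes. By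
    [nonvanishing_mul] it vanishes at all planes of [L], hence at those of [M];
    but the matrices of [M] are alternating, for which the quotient is 1/4. *)
Lemma degenerates_L4_quarter L M : leibniz L -> (exists x, L x x != 0) ->
  degenerates L M -> (forall x y, M x y = - M y x) -> ~ symmetric_off M ->
  degenerates L (form 1 0 1 4^-1).
Proof.
move=> leibL Lxx LM Manti MJ; apply: contrapT.
move=> /existsNP[M' /not_implyP[[g gl_g ->]] nclo].
have [q [qP [Lq qn]]] : exists q : alg V -> F, polyfun q /\
    (forall N, Defs.orbit L N -> q N = 0) /\ q (gact g (form 1 0 1 4^-1)) != 0.
  apply: contrapT => H; apply: nclo; apply: in_closure => q qP Lq.
  by apply/eqP/negPn/negP => qn; apply: H; exists q.
case: (qP) => p pE.
have [r rE] : upoly (fun a => q (gact g (form 1 0 1 a))).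
  apply: (upoly_ext (k := fun a => peval p (gact g (form 1 0 1 a)))).
    by move=> a; rewrite pE.
  apply/peval_curve/polycurve_gact.
  by apply: form_alg_curve; [exact: upolyC.. | exact: upolyX].
have [s sE] := closed_field_poly_normal r.
have r4 : r.[4^-1] != 0 by rewrite -rE.
pose P (a b c d : F) : F := (b - c) * \prod_(i <- s) (a * d - b * c - i * (b - c) ^+ 2).
have Preg : conic_poly P.
  split.
  - by rewrite /P subrr mul0r.
  - move=> k a b c d k0; rewrite /P mulf_eq0 negb_or prodf_seq_neq0 => /andP[bc /allP Pn].
    rewrite -mulrBr !mulf_neq0 //= prodf_seq_neq0; apply/allP => i /Pn /= Pi.
    have -> : k * a * (k * d) - k * b * (k * c) - i * (k * (b - c)) ^+ 2 =
      k ^+ 2 * (a * d - b * c - i * (b - c) ^+ 2) by ring.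
    by rewrite mulf_neq0 // expf_neq0.
  - move=> a b c d pa pb pc pd; apply: upolyM.
      by apply: upolyD => //; apply: upolyN.
    apply: upoly_prod => i; apply: upolyD.
      by apply: upolyD; [|apply: upolyN]; apply: upolyM.
    apply/upolyN/upolyM; first exact: upolyC.
    by apply: upolyXn; apply: upolyD => //; apply: upolyN.
have MP : nonvanishing P M.
  have [f [x [y [fx fy fxy]]]] : exists f x y,
      [/\ f x = 0 :> F, f y = 0 :> F & f (M x y) <> f (M y x) :> F].
    move: MJ => /existsNP[f /existsNP[x /existsNP[y]]].
    by move=> /not_implyP[fx] /not_implyP[fy] fxy; exists f, x, y.
  have sq u : M u u = 0.
    by apply: double_eq0; rewrite {1}Manti addNr.
  exists f, x, y; split=> //; rewrite !sq (Manti y x) !dualE /P.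
  set b : F := f (M x y).
  have b0 : b != 0.
    apply/eqP => b0; apply: fxy; rewrite (Manti y x) dualE -/b b0 oppr0 //.
  rewrite mulf_neq0 //; first by rewrite opprK -mulr2n -mulr_natl mulf_neq0 ?pnatr_eq0.
  rewrite prodf_seq_neq0; apply/allP => i si /=.
  have -> : 0 * 0 - b * - b - i * (b - - b) ^+ 2 = (4 * b ^+ 2) * (4^-1 - i) by field.
  rewrite !mulf_neq0 ?expf_neq0 ?pnatr_eq0 // subr_eq0.
  apply: contraNneq r4 => ->; rewrite sE hornerZ horner_prod mulf_eq0; apply/orP; right.
  by rewrite prodf_seq_eq0; apply/hasP; exists i => //=; rewrite hornerXsubC subrr.
have LP : nonvanishing P L.
  apply: (nonvanishing_closed LM) MP => f x y; apply: polyfunM.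
    by apply: polyfunD; [|apply: polyfunN]; apply: polyfun_mul.
  apply: polyfun_prod => i; apply: polyfunD.
    by apply: polyfunD; [|apply: polyfunN]; apply: polyfunM; apply: polyfun_mul.
  apply/polyfunN/polyfunM; first exact: polyfunC.
  by apply: polyfunM; apply: polyfunD;
    (apply: polyfun_mul || (apply: polyfunN; apply: polyfun_mul)).
have [f [x [y [fx fy]]]] :=
  nonvanishing_mul (@conic_b11 F) Preg (nonvanishing_square leibL Lxx) LP.
rewrite /P !mulf_eq0 !negb_or => /and3P[xx0 xy]; rewrite subr_eq0 in xy.
have deg := degenerates_L4 (dim3 := dim3) fx fy xx0 xy.
set a := (X in form 1 0 1 X) in deg.
have : r.[a] == 0.
  rewrite -rE; apply/eqP; apply: (closure_polyfun qP Lq).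
  by apply: (deg (gact g (form 1 0 1 a))); exists g.
have j0 : f (L x y) - f (L y x) != 0 by rewrite subr_eq0.
rewrite sE hornerZ mulf_eq0 => /orP[/eqP l0|].
  by move: r4; rewrite sE l0 scale0r horner0 eqxx.
rewrite horner_prod prodf_seq_eq0 => /hasP[i si /=]; rewrite hornerXsubC subr_eq0 => /eqP ai.
apply/negP; rewrite negbK prodf_seq_eq0; apply/hasP; exists i => //=.
by rewrite -ai /a divfK ?subrr // expf_neq0.
Qed.

Lemma form_alternating_neq0 : form 0 1 (- 1) 0 != 0.
Proof.
have [u0 [u1 [z [f [z0 _ _ _ /(_ 0 1 (-1) 0) /=[_ m01 _ _]]]]]] := form_alg_basis dim3.
apply/eqP => M0; move: z0; rewrite -[z]scale1r -m01 M0 zero_lfunE zero_lfunE.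
by rewrite eqxx.
Qed.

Lemma degenerates_alternating L : (forall x, L x x = 0) -> ~ symmetric_off L ->
  degenerates L (form 0 1 (- 1) 0).
Proof.
move=> Lxx /existsNP[f /existsNP[x /existsNP[y]]].
move=> /not_implyP[fx] /not_implyP[fy] fxy.
have xy : free [:: x; y] by apply: (@free_of_form F V L f); right; apply/eqP.
have Lyx := alternating_anti Lxx y x.
have b0 : f (L x y) != 0 :> F.
  by apply/eqP => b0; apply: fxy; rewrite Lyx dualE b0 oppr0.
have [g gE] := dual_normalize f (L x y).
have := @degenerates_form F V dim3 L g x y xy.
rewrite !Lxx Lyx !dualE (_ : g (L x y) = 1 :> F); last by rewrite gE divff.
apply; rewrite ?gE ?fx ?fy ?mul0r //.
by exists (L x y); rewrite gE divff // oner_eq0.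
Qed.

End Dim3.

(** Every algebra degenerates to 0, so [M] would come in between. *)
Lemma direct_zero L M : direct_degeneration L 0 -> degenerates L M -> M != 0 ->
  isomorphic M L.
Proof.
move=> [_ _ nex] LM M0; apply: contrapT => nML; apply: nex; exists M.
split=> //; last exact: degenerates0.
move=> /isoE[g [h [gh _ M0']]]; case/eqP: M0; apply: alg_ext => x y.
have := M0' (g x) (g y); rewrite !gh !zero_lfunE => /esym /(congr1 h).
by rewrite gh linear0.
Qed.

(** The algebra found between [L] and [M] is [L_4 a] or [L_5] if [M] has a
    nonzero square, and [L_4 (1/4)] if [M] is alternating. *)
Theorem level_two_chain L M : leibniz L -> ~ lie L ->
  direct_degeneration L M -> direct_degeneration M 0 ->
  [\/ (3 <= \dim {:V})%N /\ (exists a, isomorphic L (L4_a (\dim {:V}) a)),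
      (3 <= \dim {:V})%N /\ isomorphic L (L5_a F (\dim {:V}))
    | isomorphic L (r_alg F (\dim {:V}))].
Proof.
move=> leibL nlieL dLM dM0; have [LM nLM nex] := dLM.
have M0 : M != 0.
  by case: dM0 => _ nM0 _; apply/eqP => M0; apply: nM0; rewrite M0; apply: iso_refl.
have Lxx : exists x, L x x != 0.
  apply: contrapT => H; apply: nlieL; split=> //; apply: alternating_anti => x.
  by apply/eqP/negPn/negP => xx; apply: H; exists x.
have [[LJ LD]|nJD] := pselect (symmetric_off L /\ squarelike_off L).
  have [[Lc Lsq]|] := leibniz_squarelike_off leibL (erefl _) LJ LD Lxx; last by constructor 3.
  by case: nLM; apply: square_alg_closed.
have dim3 : (3 <= \dim {:V})%N.
  exact: dim3_not_symmetric_squarelike nJD.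
pose form := form_alg dim3.
have between N : degenerates L N -> degenerates N M -> ~ isomorphic N M -> isomorphic L N.
  move=> LN NM nNM; apply: iso_sym; apply: contrapT => nNL; apply: nex.
  by exists N; split.
have leibM := leibniz_closed LM leibL.
have [Mxx|Mxx] := pselect (exists x, M x x != 0).
  have isoM : isomorphic (form 1 0 0 0) M.
    apply: direct_zero dM0 (leibniz_degenerates_square leibM Mxx) _.
    have [x] := form_square_neq0 dim3 0 0 0 (oner_neq0 F).
    by apply: contraNneq => ->; rewrite !zero_lfunE.
  have Msql : squarelike M.
    exact: squarelike_closed (iso_degenerates isoM) (squarelike_form_square dim3).
  have via b c d : degenerates L (form 1 b c d) ->
      ~ (1 * d = b ^+ 2 /\ 1 * d = c ^+ 2) -> isomorphic L (form 1 b c d).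
    move=> LN nbcd; apply: between => //.
      apply: degenerates_iso isoM; apply: leibniz_degenerates_square.
        exact: leibniz_closed LN leibL.
      exact: form_square_neq0 (oner_neq0 F).
    move=> NM; apply: nbcd; apply: (squarelike_form (dim3 := dim3)).
    exact: squarelike_closed (iso_degenerates (iso_sym NM)) Msql.
  have [[a La]|L5] := leibniz_degenerates_L4_L5 dim3 leibL Lxx nJD.
    constructor 1; split=> //; exists a; rewrite L4E.
    apply: iso_trans (form_alg_iso dim3 1 0 1 a); apply: via => //.
    by move=> [-> /eqP]; rewrite expr0n expr1n eq_sym oner_eq0.
  constructor 2; split=> //; rewrite L5E.
  apply: iso_trans (form_alg_iso dim3 1 1 1 0); apply: via => //.
  by move=> [/eqP]; rewrite mulr0 expr1n eq_sym oner_eq0.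
have {}Mxx x : M x x = 0.
  by apply/eqP/negPn/negP => xx; apply: Mxx; exists x.
have Manti := alternating_anti Mxx.
have MJ : ~ symmetric_off M.
  have [|u u0 uN] := right_null_closed LM.
    by case: Lxx => x; exists (L x x) => //; apply: right_null_square.
  move=> MJ; case/eqP: M0; apply: alg_ext => x y; rewrite !zero_lfunE.
  have ul z : M u z = 0 by rewrite Manti uN oppr0.
  apply: double_eq0; rewrite {1}Manti.
  by rewrite (symmetric_off_comm MJ u0 ul uN y x) addNr.
have isoM : isomorphic (form 0 1 (- 1) 0) M.
  exact: direct_zero dM0 (degenerates_alternating Mxx MJ) (form_alternating_neq0 dim3).
constructor 1; split=> //; exists 4^-1; rewrite L4E.
apply: iso_trans (form_alg_iso dim3 1 0 1 4^-1); apply: between.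
- exact: degenerates_L4_quarter leibL Lxx LM Manti MJ.
- by apply: degenerates_iso isoM; apply: L4_quarter_degenerates.
move=> /isoE[g [h [gh hg NE]]].
have [x] := form_square_neq0 dim3 0 1 4^-1 (oner_neq0 F).
have := NE (g x) (g x); rewrite Mxx !gh => /esym /(congr1 h).
by rewrite gh linear0 => ->; rewrite eqxx.
Qed.

End LevelTwo.

Theorem theorem3 (R : realType) (n : nat) (V : vectType R[i])
    (dimV : \dim {:V} = n) (L : alg V)
    (leibnizL : leibniz L) (nonlieL : ~ lie L) (levelL : has_level L 2) :
  [\/ (3 <= n)%N /\ (exists a : R[i], isomorphic L (L4_a n a)),
      (3 <= n)%N /\ isomorphic L (L5_a R[i] n)
    | isomorphic L (r_alg R[i] n)].
Proof.
case: levelL => -[c [c0 c2 dc]] _; rewrite -dimV.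
have dLc : direct_degeneration L (c 1%N) by rewrite -c0; apply: dc.
have dc0 : direct_degeneration (c 1%N) 0 by rewrite -c2; apply: dc.
exact: level_two_chain leibnizL nonlieL dLc dc0.
Qed.
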